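(* Let $P\subset\mathbb R^2$ be a $\mathbb Z$-$\Delta_2$-free polygon whose interior contains at least two points of $\mathbb Z^2$. Then $\mathrm{width}(P)\le\frac{10}{3}$. Moreover, equality holds if and only if $P$ is $\mathbb Z$-unimodularly equivalent to the triangle $\mathrm{conv}\big(\tfrac13e_1+\tfrac53e_2,\;-\tfrac43e_1-\tfrac53e_2,\;2e_1\big)$, which contains exactly two interior lattice points.
   Context: A polygon is a two-dimensional convex polytope in $\mathbb R^2$. $\Delta_2=\mathrm{conv}(\mathbf 0,e_1,e_2)$. A $\mathbb Z$-unimodular transformation is $T(x)=Mx+b$ with $M\in\mathrm{GL}_2(\mathbb Z)$, $b\in\mathbb Z^2$; a $\mathbb Z$-unimodular copy of $X$ is $T(X)$, and two sets are $\mathbb Z$-unimodularly equivalent if one is the image of the other under such a $T$. A convex set is $\mathbb Z$-$\Delta_2$-free if its relative interior contains no $\mathbb Z$-unimodular copy of $\Delta_2$. Lattice width: $\mathrm{width}(K)=\inf_{u\in(\mathbb Z^2)^*\setminus\{0\}}\sup_{x,y\in K}|u(x)-u(y)|$. *)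

(* Defs.v *)
From Stdlib Require Import Reals ZArith.
From Coquelicot Require Import Coquelicot.
Open Scope R_scope.

Definition pt := (R * R)%type.
Definition rset := pt -> Prop.

Fixpoint rsum (n : nat) (f : nat -> R) : R :=
  match n with O => 0 | S k => rsum k f + f k end.

Definition conv (n : nat) (v : nat -> pt) : rset :=
  fun x => exists l : nat -> R,
    (forall i, (i < n)%nat -> 0 <= l i) /\
    rsum n l = 1 /\
    fst x = rsum n (fun i => l i * fst (v i)) /\
    snd x = rsum n (fun i => l i * snd (v i)).

Definition pinterior (P : rset) : rset :=
  fun x => exists eps, 0 < eps /\
    forall y : pt, (fst y - fst x)^2 + (snd y - snd x)^2 < eps^2 -> P y.

Definition polygon (P : rset) : Prop :=
  (exists (n : nat) (v : nat -> pt), forall x, P x <-> conv n v x) /\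
  (exists x, pinterior P x).

Definition vtx3 (a b c : pt) : nat -> pt :=
  fun i => match i with O => a | 1%nat => b | _ => c end.

Definition Delta2 : rset := conv 3 (vtx3 (0,0) (1,0) (0,1)).

Record unimod := Unimod { m11 : Z; m12 : Z; m21 : Z; m22 : Z; b1 : Z; b2 : Z;
  unimod_det : (m11 * m22 - m12 * m21 = 1 \/ m11 * m22 - m12 * m21 = -1)%Z }.

Definition apply_unimod (T : unimod) (x : pt) : pt :=
  (IZR (m11 T) * fst x + IZR (m12 T) * snd x + IZR (b1 T),
   IZR (m21 T) * fst x + IZR (m22 T) * snd x + IZR (b2 T)).

Definition image (T : unimod) (X : rset) : rset :=
  fun y => exists x, X x /\ y = apply_unimod T x.

Definition unimod_equiv (X Y : rset) : Prop :=
  exists T : unimod, forall y, Y y <-> image T X y.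

(* For a 2-dimensional convex set, relative pinterior = pinterior *)
Definition Delta2_free (P : rset) : Prop :=
  ~ exists T : unimod, forall y, image T Delta2 y -> pinterior P y.

Definition zpt (z : Z * Z) : pt := (IZR (fst z), IZR (snd z)).

Definition width_dir (K : rset) (u1 u2 : Z) : Rbar :=
  Lub_Rbar (fun d => exists x y, K x /\ K y /\
     d = Rabs ((IZR u1 * fst x + IZR u2 * snd x) - (IZR u1 * fst y + IZR u2 * snd y))).

(* lattice width: infimum over nonzero integer functionals (all finite for
   bounded K, which is the case for polygons) *)
Definition width (K : rset) : Rbar :=
  Glb_Rbar (fun w => exists u1 u2 : Z, (u1, u2) <> (0%Z, 0%Z) /\
                                     width_dir K u1 u2 = Finite w).

Definition Tri : rset :=
  conv 3 (vtx3 (1/3, 5/3) (-4/3, -5/3) (2, 0)).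

(* Main.v *)
Require Import Defs.
From Stdlib Require Import Reals ZArith Lra Lia Psatz Nsatz.
From Coquelicot Require Import Coquelicot.
Open Scope R_scope.

(** Move two adjacent interior lattice points of P to (0,0) and (1,0).  As P is free, no lattice
    point of the rows y = 1 and y = -1 is interior, so both slices lie between consecutive lattice
    points: in [0,1] for y = 1 after a shear, and in [b,b+1] for y = -1, with b <= 0 after a
    reflection.  Suppose that all lattice widths are at least 10/3, and let T be a top point at
    height h and B a bottom point at height -k, with h >= k.  The segments joining T and B to the
    other points of P must cross the two rows inside these intervals.  This forces the horizontal
    width below 10/3 if k <= 1 or b = 0, and if b = -1 it gives the bound 10/3, attained only by
    the triangle.  If b <= -2, either (-1,0) is interior and passing to the pair (-1,0), (0,0)
    raises b by 2, or the row y = 0 is bounded on the left by -1, which excludes b <= -3 and makes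
    the width in direction x or x - y too small when b = -2. *)

(** * Inequalities for the case b = -1 *)

(** At slope 1/2 the section on b = -1 bounds u by 1 + N/2 and w by (2-M)/(M+N), so this caps the
    width 1 + u + w at 10/3. *)
Lemma extremal_value_le M N : 0 < N -> N <= M -> M <= 2 -> 4/3 <= M + N ->
  N/2 + (2-M)/(M+N) <= 4/3.
Proof.
  intros.
  assert ((2-M)/(M+N) <= 4/3 - N/2); [|lra].
  apply Rle_div_l; nra.
Qed.

Lemma extremal_value_eq M N : 0 < N -> N <= M -> M <= 2 -> 4/3 <= M + N ->
  4/3 <= N/2 + (2-M)/(M+N) -> M = 2/3 /\ N = 2/3.
Proof.
  intros.
  assert ((4/3 - N/2) * (M+N) <= 2-M).
  { apply Rle_div_r; lra. }
  assert (M + N <= 4/3) by nra.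
  split; nra.
Qed.

Ltac pos := repeat first [apply Rplus_le_le_0_compat | apply Rmult_le_pos | apply pow_le | assumption | lra].
Lemma frac_le A B C D : 0 < B -> 0 < D -> A * D <= C * B -> A / B <= C / D.
Proof.
  intros HB HD H. apply Rle_div_l; [lra|].
  replace (C / D * B) with (C * B / D) by (field; lra).
  apply Rle_div_r; lra.
Qed.

(** The quotient g(2g'+1)/(g+g'+1) increases in both arguments and its derivative in g stays below
    2. As a bound on w it comes from eliminating the height of the rightmost point. *)
Lemma right_bound_widen g g' g1 g1' d w : 0 <= g -> 0 <= g' -> 0 <= g1 -> 0 <= d ->
  g <= g1 + d -> g' <= g1' ->
  w * (g + g' + 1) <= g * (2*g' + 1) ->
  w <= g1 * (2*g1' + 1) / (g1 + g1' + 1) + 2 * d.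
Proof.
  intros.
  assert (w <= g * (2*g'+1) / (g+g'+1)) by (apply Rle_div_r; nra).
  assert (g * (2*g'+1) / (g+g'+1) <= (g1+d) * (2*g1'+1) / (g1+d+g1'+1)).
  { apply frac_le; [lra|lra|].
    pose (a := g1+d-g). pose (b := g1'-g').
    replace (g1+d) with (g+a) by (unfold a; ring).
    replace g1' with (g'+b) by (unfold b; ring).
    assert (0<=a) by (unfold a; lra). assert (0<=b) by (unfold b; lra).
    clearbody a b.
    apply Rminus_le_0. ring_simplify. pos. }
  assert ((g1+d) * (2*g1'+1) / (g1+d+g1'+1) <= g1 * (2*g1'+1) / (g1+g1'+1) + 2*d); [|lra].
  replace (g1 * (2 * g1' + 1) / (g1 + g1' + 1) + 2 * d) with
   ((g1 * (2 * g1' + 1)  + 2 * d* (g1 + g1' + 1)) / (g1 + g1' + 1)) by (field; nra).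
  apply frac_le; [lra|lra|].
  assert (0<=g1') by lra.
  apply Rminus_le_0. ring_simplify. pos.
Qed.

(** As long as g <= g', the derivative of the same quotient is at least 1/2 in g and at most 1/2 in
    g'. *)
Lemma right_bound_narrow g1 g1' d e w : 0 <= d -> 0 <= e -> d <= g1 -> g1 <= g1' ->
  w * (g1 - d + (g1' + e) + 1) <= (g1 - d) * (2*(g1' + e) + 1) ->
  w <= g1 * (2*g1' + 1) / (g1 + g1' + 1) - d/2 + e/2.
Proof.
  intros.
  assert (w <= (g1 - d) * (2*(g1' + e) + 1) / (g1 - d + (g1' + e) + 1)) by (apply Rle_div_r; nra).
  assert ((g1 - d) * (2*(g1' + e) + 1) / (g1 - d + (g1' + e) + 1) <= g1 * (2*g1'+1) / (g1+g1'+1) - d/2 + e/2); [|lra].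
  replace (g1 * (2 * g1' + 1) / (g1 + g1' + 1) - d/2+e/2) with
   ((g1 * (2 * g1' + 1)  + (e/2-d/2)* (g1 + g1' + 1)) / (g1 + g1' + 1)) by (field; nra).
  apply frac_le; [lra|lra|].
  pose (a := g1 - d). pose (b := g1' - g1).
  replace g1' with (a+d+b) by (unfold a, b; ring).
  replace g1 with (a+d) by (unfold a; ring).
  assert (0<=a) by (unfold a; lra). assert (0<=b) by (unfold b; lra).
  clearbody a b. clear -H H0 H5 H6.
  apply Rmult_le_reg_l with 2; [lra|].
  apply Rminus_le_0. field_simplify. pos.
Qed.

(** The right bound at the reference slopes al = al' = 1/2, where ga = 1/M - 1/2 and ga' = 1/N -
    1/2. *)
Lemma extremal_right_value M N : 0 < M -> 0 < N ->
  (1/M-1/2) * (2*(1/N-1/2) + 1) / ((1/M-1/2) + (1/N-1/2) + 1) = (2-M)/(M+N).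
Proof. intros. field. repeat split; nra. Qed.

(** With al = d + 1/2 and al' = 21/10 - q, this is an affine majorant of al(2al'-1)/(al+al'-1), the
    bound on u once the height is eliminated. *)
Lemma middle_left_estimate d q : 0 <= d -> 0 <= q <= 11/10 ->
  (d+1/2) * (2*(21/10-q)-1) <= (11/10 + 9/10 * (d+1/2-1/2)) * (d+1/2 + (21/10-q) - 1).
Proof.
  intros Hd Hq. destruct (Rle_dec (6/10) q).
  - assert (0 <= d * (q-6/10)) by (apply Rmult_le_pos; lra). nra.
  - assert (0 <= q * (6/10-q)) by (apply Rmult_le_pos; lra).
    (* The difference of the two sides is quadratic in d, and the square is centred at its
       minimum. *)
    pose proof (pow2_ge_0 (d - (66/100-11/10*q)*(10/18))). nra.
Qed.

Lemma middle_right_estimate g q : 0 <= g -> 0 <= q <= 11/10 ->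
  g * (2*(11/10-q)+1) <= (16/100 + 93/100*g) * (g + (11/10-q) + 1).
Proof.
  intros Hg Hq.
    assert (0 <= q * (11/10-q)) by (apply Rmult_le_pos; lra).
    pose proof (pow2_ge_0 (g - (1087/1000-107/100*q)*(100/186))). nra.
Qed.

(** The case b = -1 in terms of slopes.  With M = h - 1 and N = k - 1, the lines from T through
    (0,1) and (1,1) are x = - al (1 - y) and x = 1 + ga (1 - y); in the coordinate x - y, the lines
    from B through (-1,-1) and (0,-1) are - al' (1 + y) and 1 + ga' (1 + y).  The leftmost and the
    rightmost abscissa are - u and 1 + w.  [c1] and [c2] say that TB crosses the two rows on the
    right of (0,1) and (-1,-1).  The extremal triangle has al = al' = 1/2, and the estimates compare
    with this slope. *)
Section offset_m1.
Variables M N al ga al' ga' u w : R.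
Hypotheses (N0 : 0 < N) (NM : N <= M) (MN : 4/3 <= M + N)
  (al0 : 0 <= al) (ga0 : 0 <= ga) (al0' : 0 <= al') (ga0' : 0 <= ga')
  (eM : al + ga = 1/M) (eN : al' + ga' = 1/N)
  (c1 : 1 + N <= al * (2+N) + al' * N)
  (c2 : 1 + M <= al' * (2+M) + al * M)
  (hw : w * (ga + ga' + 1) <= ga * (2*ga' + 1))
  (huw : 7/3 <= u + w).

Let eM' : M * (al + ga) = 1. Proof. rewrite eM. field. lra. Qed.
Let eN' : N * (al' + ga') = 1. Proof. rewrite eN. field. lra. Qed.

Lemma right_le_double : w <= 2 * ga.
Proof. nra. Qed.

(** If M >= 2, then u + w <= (2+M)(al+ga) = 1 + 2/M <= 2, which is below 7/3. *)
Lemma top_excess_lt_2 : u <= al * (2 + N) -> M < 2.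
Proof.
  intros. pose proof right_le_double. apply Rnot_le_lt. intro.
  assert (u + w <= (2+M) * (al+ga)) by nra.
  assert ((2+M) * (al+ga) = 1 + 2 * (al + ga)) by lra.
  nra.
Qed.

(** For al <= 1/2, [c1] forces al' >= 1/2. So ga' is at most its reference value, and ga exceeds its
    own by 1/2 - al. *)
Lemma right_bound_flat : M < 2 -> al <= 1/2 -> w <= (2-M)/(M+N) + 2*(1/2-al).
Proof.
  intros. rewrite <-(extremal_right_value M N) by lra.
  apply right_bound_widen with ga ga'; try lra.
  - assert (1/2 <= 1/M) by (apply frac_le; lra). lra.
  - assert (0 <= (1/2-al)*(2+N)) by (apply Rmult_le_pos; lra).
    assert (0 <= (al'-1/2)*N) by lra. assert (0 <= al' - 1/2) by (apply Rnot_lt_le; intro; nra). lra.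
Qed.

(** With d = al - 1/2, [c2] lets al' fall below 1/2 by at most dM/(2+M); this is the possible gain
    of ga' against the loss d of ga. *)
Lemma right_bound_steep : M < 2 -> 1/2 <= al -> w <= (2-M)/(M+N) - (al-1/2)/2 + (al-1/2)*M/(2+M)/2.
Proof.
  intros. rewrite <-(extremal_right_value M N) by lra.
  pose (d := al - 1/2). fold d.
  assert (0 <= d*M/(2+M)) by (apply Rdiv_le_0_compat; unfold d; nra).
  assert (1/M <= 1/N) by (apply frac_le; lra).
  set (g2 := 1 / N - 1 / 2 + d * M / (2 + M)).
  assert (ga' <= g2).
  { assert (1/2 - d * M / (2 + M) <= al'); [|unfold g2; lra].
    replace (1/2 - d * M / (2 + M)) with ((1 + M/2 - d*M)/(2+M)) by (field; lra).
    apply Rle_div_l; unfold d; lra. }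
  assert (0 <= g2) by lra.
  assert (w <= ga*(2*ga'+1)/(ga+ga'+1)) by (apply Rle_div_r; nra).
  assert (ga*(2*ga'+1)/(ga+ga'+1) <= ga*(2*g2+1)/(ga+g2+1)).
  { apply frac_le; try lra. assert (0 <= ga * (g2-ga') * (2*ga+1)) by (repeat apply Rmult_le_pos; lra). lra. }
  assert (w * (ga+g2+1) <= ga*(2*g2+1)) by (apply Rle_div_r; lra).
  replace ga with (1/M-1/2-d) in H7 by (unfold d; lra).
  apply right_bound_narrow; fold g2; try lra; unfold d; lra.
Qed.

(** For either sign of al - 1/2, u + w <= 1 + (2-M)/(M+N), which is strictly below 7/3 because N >
    0. *)
Lemma leftmost_near_absurd : M < 2 -> u <= 2 * al -> u <= 1 -> False.
Proof.
  intros.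
  pose proof (extremal_value_le M N N0 NM ltac:(lra) MN).
  destruct (Rle_dec al (1/2)).
  - pose proof (right_bound_flat H r). lra.
  - pose proof (right_bound_steep H ltac:(lra)).
    assert ((al-1/2)*M/(2+M) <= al - 1/2) by (apply Rle_div_l; nra).
    lra.
Qed.

(** If u > 1, then al' > 1, and M and N are confined to ranges in which affine bounds on u and w add
    up to less than 7/3. *)
Lemma leftmost_middle_absurd y : -1 <= y <= 1 -> u <= al * (1-y) -> u <= al' * (1+y) - y -> False.
Proof.
  intros.
  assert (M < 2) by (apply top_excess_lt_2; nra).
  assert (u <= 2*al) by nra.
  destruct (Rle_dec u 1). { now apply leftmost_near_absurd. }
  assert (1 < al') by nra.
  assert (1/2 < al) by lra.
  pose proof right_le_double.
  (* Otherwise u + w <= 2(al+ga) = 2/M < 7/3. *)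
  assert (M <= 6/7) by (apply Rnot_lt_le; intro; nra).
  assert (10/21 <= N) by lra.
  assert (al' + ga' <= 21/10). { nra. }
  assert (al + ga <= 3/2) by nra.
  assert (u <= 11/10 + 9/10 * (al-1/2)).
  (* The weights al' - 1 and al cancel the height y. *)
  { assert (0 <= (al'-1) * (al*(1-y) - u)) by (apply Rmult_le_pos; lra).
    assert (0 <= al * (al'*(1+y) - y - u)) by (apply Rmult_le_pos; lra).
    assert (u * (al + al' - 1) <= al * (2*al'-1)) by lra.
    assert (al * (2*al'-1) <= (11/10 + 9/10 * (al-1/2)) * (al + al' - 1)); [|apply Rmult_le_reg_r with (al+al'-1); lra].
    pose (q := 21/10 - al'). pose (d := al - 1/2).
    replace al' with (21/10 - q) by (unfold q; ring).
    replace al with (d + 1/2) by (unfold d; ring).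
    assert (0 <= q <= 11/10) by (unfold q; lra). assert (0 <= d) by (unfold d; lra).
    apply middle_left_estimate; assumption. }
  assert (w <= 16/100 + 93/100 * ga).
  { assert (ga' <= 11/10) by lra. assert (ga * (2*ga'+1) <= (16/100 + 93/100 * ga) * (ga+ga'+1)); [|apply Rmult_le_reg_r with (ga+ga'+1); lra].
    pose (q := 11/10 - ga').
    replace ga' with (11/10 - q) by (unfold q; ring).
    apply middle_right_estimate; unfold q; lra. }
  lra.
Qed.

(** The two bounds on u come from joining a low leftmost point to the top, passing to the right of
    (0,1) and of (-1,-1). The first is used for al <= 1/2, the second for al > 1/2. *)
Lemma leftmost_low_extremal : u <= al * (2 + N) -> u * (2+M) <= 2 + M + N + al*M*N ->
  M = 2/3 /\ N = 2/3 /\ al = 1/2 /\ u = 4/3 /\ w = 1 /\ al' = 1/2.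
Proof.
  intros.
  assert (M < 2) by now apply top_excess_lt_2.
  pose proof (extremal_value_le M N N0 NM ltac:(lra) MN).
  pose proof (extremal_value_eq M N N0 NM ltac:(lra) MN).
  assert (HH : M = 2/3 /\ N = 2/3 /\ al = 1/2).
  { destruct (Rle_dec al (1/2)).
    - pose proof (right_bound_flat H1 r).
      assert (u = 1 + N/2 - (1/2-al) * (2 + N)) by nra.
      assert (al = 1/2) by nra.
      nra.
    - pose proof (right_bound_steep H1 ltac:(lra)).
      set (d := al-1/2) in *.
      assert (0 < d) by (unfold d; lra).
      assert (u <= 1 + N/2 + d * M * N/(2+M)).
      { replace (1 + N/2 + d * M * N/(2+M)) with ((2 + M + N + al*M*N)/(2+M)) by (unfold d; field; lra).
        apply Rle_div_r; lra. }
      (* This is the total change in the bound on u + w caused by the slope excess d. *)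
      assert (dE : d * M * N/(2+M) - d/2 + d*M/(2+M)/2 = d * (M*N-1)/(2+M)) by (field; lra).
      destruct (Rle_dec (M*N) 1).
      + assert (d * (M*N-1)/(2+M) <= 0). { apply Rle_div_l; nra. }
        destruct (H3 ltac:(lra)) as [e1 e2]. assert (d * (M*N-1)/(2+M) < 0) by (rewrite e1, e2; lra). lra.
      (* For MN > 1 the bound may grow with d, but M + N >= 2 keeps the total at most 9/4. *)
      + exfalso.
        assert (d * (M*N-1)/(2+M) <= 1/4).
        { apply Rle_div_l; [lra|]. assert (d * M <= 1 - M/2) by (unfold d; nra).
          assert (0 <= (1 - M/2 - d*M) * N) by (apply Rmult_le_pos; lra).
          assert (0 <= (1 - M/2) * (M - N)) by (apply Rmult_le_pos; lra).
          pose proof (pow2_ge_0 (M-1)). lra. }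
        assert (2 <= M + N) by nra.
        assert ((2-M)/(M+N) <= 1 - M/2).
        { apply Rle_div_l; [lra|]. assert (0 <= (1-M/2) * (M+N-2)) by (apply Rmult_le_pos; lra). lra. }
        lra. }
  destruct HH as (e1 & e2 & e3).
  assert (ga = 1) by nra.
  assert (1/2 <= al') by nra.
  assert (ga' <= 1) by nra.
  assert (w <= 1) by nra.
  assert (u <= 4/3) by nra.
  assert (w = 1) by lra.
  assert (ga' = 1) by nra.
  repeat split; nra.
Qed.
End offset_m1.

(** * Harmonic-mean estimate for the case b = 0 *)

(** The left side is a sum of two halved harmonic means, which is superadditive. *)
Lemma harmonic_split t s M N : 0 <= t <= 1 -> 0 <= s <= 1 -> 0 < M -> 0 < N ->
  0 < t*N+s*M -> 0 < (1-t)*N+(1-s)*M ->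
  t*s/(t*N+s*M) + (1-t)*(1-s)/((1-t)*N+(1-s)*M) <= 1/(M+N).
Proof.
  intros.
  set (D1 := t*N+s*M) in *. set (D2 := (1-t)*N+(1-s)*M) in *.
  replace (t*s/D1 + (1-t)*(1-s)/D2) with ((t*s*D2 + (1-t)*(1-s)*D1)/(D1*D2)) by (field; lra).
  apply frac_le; [nra|lra|].
  replace (M+N) with (D1+D2) by (unfold D1, D2; ring).
  assert (0 <= M*N*(t*(1-s)-(1-t)*s)^2).
  { apply Rmult_le_pos; [nra|apply pow2_ge_0]. }
  assert (M*N*(t*(1-s)-(1-t)*s)^2 = (t*D2-(1-t)*D1)*((1-s)*D1-s*D2)) by (unfold D1, D2; ring).
  lra.
Qed.

(** The weights s and t on the two bounds for u cancel y. *)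
Lemma harmonic_bound t s M N u y : 0 <= t -> 0 <= s -> 0 < M -> 0 < N -> 0 < t*N+s*M ->
  u*M <= t*(1-y) -> u*N <= s*(1+y) -> u <= 2*(t*s/(t*N+s*M)).
Proof.
  intros.
  replace (2*(t*s/(t*N+s*M))) with (2*t*s/(t*N+s*M)) by (field; lra).
  apply Rle_div_r; [lra|].
  assert (0 <= s*(t*(1-y)-u*M)) by (apply Rmult_le_pos; lra).
  assert (0 <= t*(s*(1+y)-u*N)) by (apply Rmult_le_pos; lra). lra.
Qed.

Lemma harmonic_width_bound t s M N u w y z : 0 <= t <= 1 -> 0 <= s <= 1 -> 0 < M -> 0 < N -> 4/3 <= M+N ->
  u*M <= t*(1-y) -> u*N <= s*(1+y) -> w*M <= (1-t)*(1-z) -> w*N <= (1-s)*(1+z) ->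
  u + w <= 3/2.
Proof.
  intros.
  assert (1/(M+N) <= 3/4) by (apply Rle_div_l; lra).
  (* A denominator vanishes only for t = s = 0 or for t = s = 1; then one of u and w is at most 0
     and the other at most 2/(M+N). *)
  destruct (Req_dec (t*N+s*M) 0) as [e|e].
  { assert (t = 0) by nra. assert (s = 0) by nra. subst t s.
    assert (u <= 0) by nra.
    assert (w * (M+N) <= 2) by lra. nra. }
  destruct (Req_dec ((1-t)*N+(1-s)*M) 0) as [e'|e'].
  { assert (t = 1) by nra. assert (s = 1) by nra. subst t s.
    assert (w <= 0) by nra.
    assert (u * (M+N) <= 2) by lra. nra. }
  assert (0 < t*N+s*M) by nra. assert (0 < (1-t)*N+(1-s)*M) by nra.
  pose proof (harmonic_split t s M N).
  pose proof (harmonic_bound t s M N u y).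
  pose proof (harmonic_bound (1-t) (1-s) M N w z).
  lra.
Qed.

(** * Convex sets and segments crossing a row *)

Definition convexset (Q : rset) : Prop := forall x1 y1 x2 y2 l, Q (x1, y1) -> Q (x2, y2) ->
  0 <= l <= 1 -> Q ((1-l)*x1 + l*x2, (1-l)*y1 + l*y2).

Lemma crossing Q x1 y1 x2 y2 c : convexset Q -> Q (x1,y1) -> Q (x2,y2) -> y1 < y2 -> y1 <= c <= y2 ->
  Q ((x1*(y2-c) + x2*(c-y1))/(y2-y1), c).
Proof.
  intros HQ H1 H2 Hy Hc.
  assert (Hl : 0 <= (c-y1)/(y2-y1) <= 1).
  { split; [apply Rdiv_le_0_compat; lra | apply Rle_div_l; lra]. }
  pose proof (HQ _ _ _ _ _ H1 H2 Hl) as H.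
  match goal with |- Q ?p => replace p with ((1 - (c - y1) / (y2 - y1)) * x1 + (c - y1) / (y2 - y1) * x2,
     (1 - (c - y1) / (y2 - y1)) * y1 + (c - y1) / (y2 - y1) * y2) end; [exact H|].
  f_equal; field; lra.
Qed.

(** The right side is the abscissa at which the segment meets the row y = c, multiplied by y2 - y1
    so that no division remains. *)
Lemma cross_ge Q x1 y1 x2 y2 c lo : convexset Q -> (forall x, Q (x,c) -> lo <= x) ->
  Q (x1,y1) -> Q (x2,y2) -> y1 < y2 -> y1 <= c <= y2 ->
  lo*(y2-y1) <= x1*(y2-c) + x2*(c-y1).
Proof.
  intros HQ Hc H1 H2 Hy Hcy.
  apply Rle_div_r; [lra|]. apply Hc. now apply crossing.
Qed.

Lemma cross_le Q x1 y1 x2 y2 c hi : convexset Q -> (forall x, Q (x,c) -> x <= hi) ->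
  Q (x1,y1) -> Q (x2,y2) -> y1 < y2 -> y1 <= c <= y2 ->
  x1*(y2-c) + x2*(c-y1) <= hi*(y2-y1).
Proof.
  intros HQ Hc H1 H2 Hy Hcy.
  apply Rle_div_l; [lra|]. apply Hc. now apply crossing.
Qed.

(** * Width bounds according to the offset b of the lower row *)

(** [rng] makes (t,h) a top point and (p,-k) a bottom point. *)
Section cases.
Variables (Q : rset) (h k t p : R).
Hypotheses (cQ : convexset Q) (q0 : Q (0,0)) (q1 : Q (1,0))
  (lo1 : forall x, Q (x,1) -> 0 <= x) (hi1 : forall x, Q (x,1) -> x <= 1)
  (qT : Q (t,h)) (qB : Q (p,-k)) (rng : forall x y, Q (x,y) -> -k <= y <= h)
  (kh : k <= h) (hk : 10/3 <= h + k).

Lemma row_above x y : Q (x,y) -> 1 <= y -> 0 <= x <= 1.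
Proof.
  intros H Hy.
  pose proof (cross_ge Q 0 0 x y 1 0 cQ lo1 q0 H ltac:(lra) ltac:(lra)).
  pose proof (cross_le Q 1 0 x y 1 1 cQ hi1 q1 H ltac:(lra) ltac:(lra)). lra.
Qed.

Lemma top_abscissa : 0 <= t <= 1.
Proof. apply row_above with h; [assumption|lra]. Qed.

(** Joined to the top point, (x,y) must cross the row y = 1 inside [0,1]. *)
Lemma below_upper_row x y : Q (x,y) -> y <= 1 -> -x*(h-1) <= t*(1-y) /\ (x-1)*(h-1) <= (1-t)*(1-y).
Proof.
  intros H Hy.
  pose proof (cross_ge Q x y t h 1 0 cQ lo1 H qT ltac:(lra) ltac:(lra)).
  pose proof (cross_le Q x y t h 1 1 cQ hi1 H qT ltac:(lra) ltac:(lra)). lra.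
Qed.

(** Since 1 - y <= 2 on all of [Q], the horizontal width minus 1, multiplied by h - 1 >= 4/3, is at
    most 2. *)
Lemma thin_below xa ya xc yc : k <= 1 -> Q (xa,ya) -> Q (xc,yc) -> 10/3 <= xc - xa -> False.
Proof.
  intros Hk Ha Hc Hw.
  assert (-xa*(h-1) <= 2*t).
  { pose proof (rng _ _ Ha). pose proof top_abscissa. destruct (Rle_dec ya 1) as [l|l].
    - pose proof (below_upper_row _ _ Ha l). nra.
    - pose proof (row_above _ _ Ha ltac:(lra)). nra. }
  assert ((xc-1)*(h-1) <= 2*(1-t)).
  { pose proof (rng _ _ Hc). pose proof top_abscissa. destruct (Rle_dec yc 1) as [l|l].
    - pose proof (below_upper_row _ _ Hc l). nra.
    - pose proof (row_above _ _ Hc ltac:(lra)). nra. }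
  nra.
Qed.

Section lower.
Variable b : R.
Hypotheses (k1 : 1 < k) (lo2 : forall x, Q (x,-1) -> b <= x) (hi2 : forall x, Q (x,-1) -> x <= b+1).

(** In the coordinate x + by the slice [b,b+1] of the row y = -1 becomes [0,1], so the region below
    mirrors the one above the row y = 1. *)
Lemma row_below x y : Q (x,y) -> y <= -1 -> 0 <= x+b*y <= 1.
Proof.
  intros H Hy.
  pose proof (cross_ge Q x y 0 0 (-1) b cQ lo2 H q0 ltac:(lra) ltac:(lra)).
  pose proof (cross_le Q x y 1 0 (-1) _ cQ hi2 H q1 ltac:(lra) ltac:(lra)). lra.
Qed.

Lemma bottom_abscissa : 0 <= p-b*k <= 1.
Proof. pose proof (row_below _ _ qB ltac:(lra)). lra. Qed.

Lemma above_lower_row x y : Q (x,y) -> -1 <= y ->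
  -(x+b*y)*(k-1) <= (p-b*k)*(1+y) /\ (x+b*y-1)*(k-1) <= (1-(p-b*k))*(1+y).
Proof.
  intros H Hy.
  pose proof (cross_ge Q p (-k) x y (-1) b cQ lo2 qB H ltac:(lra) ltac:(lra)).
  pose proof (cross_le Q p (-k) x y (-1) _ cQ hi2 qB H ltac:(lra) ltac:(lra)). lra.
Qed.

(** For b = 0 the same coordinate x is controlled from above and from below, and
    [harmonic_width_bound] limits the width to 1 + 3/2. *)
Lemma offset_0_narrow xa ya xc yc : b = 0 -> Q (xa,ya) -> Q (xc,yc) -> 10/3 <= xc - xa -> False.
Proof.
  intros Hb Ha Hc Hw.
  pose proof top_abscissa as Ht. pose proof bottom_abscissa as Hs. rewrite Hb in Hs.
  assert (exists y, -xa*(h-1) <= t*(1-y) /\ -xa*(k-1) <= (p-b*k)*(1+y)) as (y & A1 & A2).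
  { destruct (Rle_dec ya 1) as [l|l]; [destruct (Rle_dec (-1) ya) as [l'|l']|].
    - exists ya. pose proof (below_upper_row _ _ Ha l). pose proof (above_lower_row _ _ Ha l'). rewrite Hb in *. lra.
    (* Outside the strip |y| <= 1 the abscissa is at least 0, so any height in [-1,1] would
       serve. *)
    - exists 0. pose proof (row_below _ _ Ha ltac:(lra)). rewrite Hb in *. nra.
    - exists 0. pose proof (row_above _ _ Ha ltac:(lra)). rewrite Hb in *. nra. }
  assert (exists y, (xc-1)*(h-1) <= (1-t)*(1-y) /\ (xc-1)*(k-1) <= (1-(p-b*k))*(1+y)) as (z & C1 & C2).
  { destruct (Rle_dec yc 1) as [l|l]; [destruct (Rle_dec (-1) yc) as [l'|l']|].
    - exists yc. pose proof (below_upper_row _ _ Hc l). pose proof (above_lower_row _ _ Hc l'). rewrite Hb in *. lra.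
    - exists 0. pose proof (row_below _ _ Hc ltac:(lra)). rewrite Hb in *. nra.
    - exists 0. pose proof (row_above _ _ Hc ltac:(lra)). rewrite Hb in *. nra. }
  rewrite Hb in *.
  pose proof (harmonic_width_bound t (p-0*k) (h-1) (k-1) (-xa) (xc-1) y z Ht Hs). lra.
Qed.

Lemma offset_m1_extremal xa ya xc yc : b = -1 -> Q (xa,ya) -> Q (xc,yc) -> 10/3 <= xc - xa ->
  h = 5/3 /\ k = 5/3 /\ t = 1/3 /\ (xa,ya) = (-4/3,-5/3) /\ (xc,yc) = (2,0).
Proof.
  intros Hb Ha Hc Hw.
  pose proof top_abscissa as Ht. pose proof bottom_abscissa as Hs. rewrite Hb in Hs.
  set (M := h-1). set (N := k-1). set (s := p - -1*k) in *.
  set (al := t/M). set (ga := (1-t)/M). set (al' := s/N). set (ga' := (1-s)/N).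
  assert (M0 : 0 < M) by (unfold M; lra). assert (N0 : 0 < N) by (unfold N; lra).
  assert (eM : al + ga = 1/M) by (unfold al, ga; field; lra).
  assert (eN : al' + ga' = 1/N) by (unfold al', ga'; field; lra).
  assert (et : t = al*M) by (unfold al; field; lra).
  assert (es : s = al'*N) by (unfold al'; field; lra).
  assert (al0 : 0 <= al) by (apply Rdiv_le_0_compat; lra).
  assert (ga0 : 0 <= ga) by (apply Rdiv_le_0_compat; lra).
  assert (al0' : 0 <= al') by (apply Rdiv_le_0_compat; lra).
  assert (ga0' : 0 <= ga') by (apply Rdiv_le_0_compat; lra).
  (* A low point joined to the top crosses the rows y = 1 and y = -1 to the right of (0,1) and
     (-1,-1). Applied to the bottom point this yields [c1] and [c2]. *)
  assert (Hlow : forall x y, Q (x,y) -> y <= -1 ->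
     -x <= al*(1-y) /\ -x*(2+M) <= 2 + M - y-1 + al*M*(-y-1)).
  { intros x y H Hy. split.
    - pose proof (below_upper_row _ _ H ltac:(lra)). replace (al*(1-y)) with (t*(1-y)/M) by (unfold al; field; lra).
      apply Rle_div_r; unfold M in *; lra.
    - pose proof (cross_ge Q x y t h (-1) b cQ lo2 H qT ltac:(lra) ltac:(lra)) as E.
      rewrite Hb in E. rewrite <- et. unfold M. lra. }
  assert (c1 : 1 + N <= al * (2+N) + al' * N).
  { destruct (Hlow _ _ qB ltac:(lra)) as [E _]. unfold N in *. unfold s in *. lra. }
  assert (c2 : 1 + M <= al' * (2+M) + al * M).
  { destruct (Hlow _ _ qB ltac:(lra)) as [_ E]. replace (-p) with (1+N-al'*N) in E by (unfold N in *; unfold s in *; lra).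
    replace (- - k) with (1+N) in E by (unfold N; ring).
    apply Rmult_le_reg_r with N; [lra|]. unfold N in *. lra. }
  set (u := -xa). set (w := xc - 1).
  assert (huw : 7/3 <= u + w) by (unfold u, w; lra).
  assert (Cc : -1 <= yc <= 1 -> w <= ga*(1-yc) /\ w <= ga'*(1+yc) + yc).
  { intros Hy. pose proof (below_upper_row _ _ Hc ltac:(lra)) as [_ E1]. pose proof (above_lower_row _ _ Hc ltac:(lra)) as [_ E2].
    split.
    - replace (ga*(1-yc)) with ((1-t)*(1-yc)/M) by (unfold ga; field; lra).
      apply Rle_div_r; unfold M, w in *; lra.
    - assert (w-yc <= ga'*(1+yc)); [|lra]. replace (ga'*(1+yc)) with ((1-s)*(1+yc)/N) by (unfold ga'; field; lra).
      rewrite Hb in E2. apply Rle_div_r; unfold N, s, w in *; lra. }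
  assert (Cc' : w <= 0 \/ -1 <= yc <= 1).
  { destruct (Rle_dec yc 1) as [l|l]; [destruct (Rle_dec (-1) yc) as [l'|l']|].
    - right; lra.
    - left. pose proof (row_below _ _ Hc ltac:(lra)) as E. rewrite Hb in E. unfold w. lra.
    - left. pose proof (row_above _ _ Hc ltac:(lra)) as E. unfold w. lra. }
  (* The weights ga' + 1 and ga cancel [yc] in the two bounds on w. *)
  assert (hw : w * (ga + ga' + 1) <= ga * (2*ga' + 1)).
  { destruct Cc' as [l|l].
    - assert (0 <= -w * (ga + ga' + 1)) by (apply Rmult_le_pos; lra).
      assert (0 <= ga * (2*ga'+1)) by (apply Rmult_le_pos; lra). lra.
    - destruct (Cc l). assert (0 <= (ga'+1)*(ga*(1-yc)-w)) by (apply Rmult_le_pos; lra).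
      assert (0 <= ga*(ga'*(1+yc)+yc-w)) by (apply Rmult_le_pos; lra). lra. }
  assert (NM : N <= M) by (unfold M, N; lra).
  assert (MN : 4/3 <= M + N) by (unfold M, N; lra).
  (* The left point lies below, between or above the two rows; only the first position is
     possible. *)
  destruct (Rle_dec ya (-1)) as [l|l]; [|exfalso; destruct (Rle_dec ya 1) as [l'|l']].
  - destruct (Hlow _ _ Ha l) as [E1 E2]. fold u in E1, E2.
    assert (Hv : -ya <= 1+N) by (pose proof (rng _ _ Ha); unfold N; lra).
    assert (A1 : u <= al*(2+N)).
    { assert (0 <= al * (1+N+ya)) by (apply Rmult_le_pos; lra). lra. }
    assert (A2 : u*(2+M) <= 2 + M + N + al*M*N).
    { assert (0 <= al*M * (1+N+ya)) by (apply Rmult_le_pos; [apply Rmult_le_pos; lra|lra]). lra. }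
    destruct (leftmost_low_extremal M N al ga al' ga' u w) as (eM1 & eN1 & e3 & e4 & e5 & e6); try assumption.
    assert (ga = 1) by (rewrite eM1 in eM; lra). assert (ga' = 1) by (rewrite eN1 in eN; lra).
    (* With w = ga = ga' = 1 the two bounds on the right point force [yc] = 0. *)
    destruct Cc' as [l'|l']; [lra|]. destruct (Cc l') as [F1 F2].
    rewrite H in F1. rewrite H0 in F2. rewrite e3 in *. rewrite e4 in *.
    rewrite eM1 in *. rewrite eN1 in *.
    unfold M, N, u, w in *.
    repeat split; try lra; f_equal; lra.
  - pose proof (below_upper_row _ _ Ha l') as [E1 _]. pose proof (above_lower_row _ _ Ha ltac:(lra)) as [E2 _].
    apply (leftmost_middle_absurd M N al ga al' ga' u w) with ya; try assumption; try lra.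
    + replace (al*(1-ya)) with (t*(1-ya)/M) by (unfold al; field; lra).
      apply Rle_div_r; unfold M, u in *; lra.
    + assert (u+ya <= al'*(1+ya)); [|lra]. replace (al'*(1+ya)) with (s*(1+ya)/N) by (unfold al'; field; lra).
      rewrite Hb in E2. apply Rle_div_r; unfold N, s, u in *; lra.
  - pose proof (row_above _ _ Ha ltac:(lra)) as E.
    apply (leftmost_near_absurd M N al ga al' ga' u w); try assumption; try (unfold u in *; lra).
    eapply top_excess_lt_2 with (ga:=ga) (ga':=ga') (al':=al') (w:=w) (al:=al) (u:=u) (N:=N); try assumption.
    assert (0 <= al*(2+N)) by (apply Rmult_le_pos; lra). unfold u; lra.
Qed.

(** The segment TB meets the row y = 0 no further left than -1. With p <= 1 - 3k and t <= 1 this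
    gives 3hk <= 2(h+k), impossible for h >= k > 1 and h + k >= 10/3. *)
Lemma offset_le_m3_absurd : (forall x, Q (x,0) -> -1 <= x) -> b <= -3 -> False.
Proof.
  intros lo0 Hb. pose proof bottom_abscissa. pose proof top_abscissa.
  pose proof (cross_ge Q p (-k) t h 0 _ cQ lo0 qB qT ltac:(lra) ltac:(lra)).
  assert (0 <= (-3-b)*(k*h)) by (apply Rmult_le_pos; nra).
  assert (0 <= (1 - (p-b*k))*h) by (apply Rmult_le_pos; lra).
  assert (0 <= (1 - t)*k) by (apply Rmult_le_pos; lra).
  nra.
Qed.

(** The coordinate x - y lies halfway between x, controlled from above, and x - 2y, controlled from
    below. The width in direction x and the segment TB confine M and N; then the width in direction
    x - y is too small. *)
Lemma offset_m2_narrow xa ya xc yc xa' ya' xc' yc' : (forall x, Q (x,0) -> -1 <= x) -> b = -2 ->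
  Q (xa,ya) -> Q (xc,yc) -> 10/3 <= xc - xa ->
  Q (xa',ya') -> Q (xc',yc') -> 10/3 <= (xc'-yc') - (xa'-ya') -> False.
Proof.
  intros lo0 Hb Ha Hc Hw Ha' Hc' Hw'.
  pose proof top_abscissa as Ht. pose proof bottom_abscissa as Hs. rewrite Hb in Hs.
  set (M := h-1) in *. set (N := k-1) in *.
  set (ta := 1-t). set (si := 1 - (p - -2*k)).
  assert (M0 : 0 < M) by (unfold M; lra). assert (N0 : 0 < N) by (unfold N; lra).
  assert (NM : N <= M) by (unfold M, N; lra).
  assert (MN : 4/3 <= M + N) by (unfold M, N; lra).
  assert (X : 7*M <= 6+3*N).
  { assert (-xa*M <= t*(2+N)).
    { pose proof (rng _ _ Ha). destruct (Rle_dec ya 1) as [l|l].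
      - pose proof (below_upper_row _ _ Ha l) as [E _]. fold M in E.
        assert (0 <= t*(1+N+ya)) by (apply Rmult_le_pos; unfold N; lra). lra.
      - pose proof (row_above _ _ Ha ltac:(lra)).
        assert (0 <= xa*M) by (apply Rmult_le_pos; lra).
        assert (0 <= t*(2+N)) by (apply Rmult_le_pos; lra). lra. }
    assert ((xc-1)*M <= 2*(1-t)).
    { destruct (Rle_dec yc 1) as [l|l]; [destruct (Rle_dec (-1) yc) as [l'|l']|].
      - pose proof (below_upper_row _ _ Hc l) as [_ E]. fold M in E.
        assert (0 <= (1-t)*(1+yc)) by (apply Rmult_le_pos; lra). lra.
      - pose proof (row_below _ _ Hc ltac:(lra)) as E. rewrite Hb in E.
        assert (0 <= (1-xc)*M) by (apply Rmult_le_pos; lra). lra.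
      - pose proof (row_above _ _ Hc ltac:(lra)).
        assert (0 <= (1-xc)*M) by (apply Rmult_le_pos; lra). lra. }
    assert (0 <= (xc-xa-10/3)*M) by (apply Rmult_le_pos; lra).
    assert (0 <= (1-t)*N) by (apply Rmult_le_pos; lra). lra. }
  assert (TB : ta*(1+N) + si*(1+M) <= 2*(1-M*N)).
  { pose proof (cross_ge Q p (-k) t h 0 _ cQ lo0 qB qT ltac:(lra) ltac:(lra)). unfold ta, si, M, N. lra. }
  assert (ta0 : 0 <= ta <= 1) by (unfold ta; lra). assert (si0 : 0 <= si <= 1) by (unfold si; lra).
  assert (N3 : 1/3 <= N) by lra.
  assert (P0 : M*N <= 1).
  { assert (0 <= ta*(1+N)) by (apply Rmult_le_pos; lra). assert (0 <= si*(1+M)) by (apply Rmult_le_pos; lra). lra. }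
  assert (N1 : N <= 1) by nra.
  set (r := xc'-yc'-1). set (u := ya'-xa').
  (* Eliminating the height bounds r by a quotient in g and g', which is at most g + g' because
     (g-g')^2 >= 0. *)
  assert (Hr : r <= ta/(2*M) + si/(2*N)).
  { assert (P1 : 0 <= ta/(2*M)) by (apply Rdiv_le_0_compat; lra).
    assert (P2 : 0 <= si/(2*N)) by (apply Rdiv_le_0_compat; lra).
    destruct (Rle_dec yc' 1) as [l|l]; [destruct (Rle_dec (-1) yc') as [l'|l']|].
    - pose proof (below_upper_row _ _ Hc' l) as [_ E1]. pose proof (above_lower_row _ _ Hc' l') as [_ E2]. rewrite Hb in E2.
      fold M ta in E1. fold N si in E2.
      set (g := ta/(2*M)) in *. set (g' := si/(2*N)) in *.
      assert (F1 : r + yc' <= 2*g*(1-yc')).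
      { replace (2*g*(1-yc')) with (ta*(1-yc')/M) by (unfold g; field; lra). apply Rle_div_r; unfold r; lra. }
      assert (F2 : r - yc' <= 2*g'*(1+yc')).
      { replace (2*g'*(1+yc')) with (si*(1+yc')/N) by (unfold g'; field; lra). apply Rle_div_r; unfold r; lra. }
      assert (0 <= (2*g'+1)*(2*g*(1-yc') - r - yc')) by (apply Rmult_le_pos; lra).
      assert (0 <= (2*g+1)*(2*g'*(1+yc') - r + yc')) by (apply Rmult_le_pos; lra).
      pose proof (pow2_ge_0 (g-g')).
      apply Rmult_le_reg_r with (2*g+2*g'+2); lra.
    - pose proof (row_below _ _ Hc' ltac:(lra)) as E. rewrite Hb in E. unfold r. lra.
    - pose proof (row_above _ _ Hc' ltac:(lra)). unfold r; lra. }
  (* A left point above the row y = 0 is joined to B, one below it to T; the segment must pass to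
     the right of (-1,0). Beyond the rows y = 1 and y = -1 the bound of that row is used too. *)
  assert (Hu : u <= 1 \/ u*(1+N) <= 2 - si \/ u*(1+M) <= 2 - ta).
  { pose proof (rng _ _ Ha') as [R1 R2].
    assert (X1 : M*(1+N) <= 2+N) by lra. assert (X2 : N*(1+M) <= 2+M) by lra.
    destruct (Rle_dec 0 ya') as [l|l].
    - destruct (Rle_dec ya' 0) as [z|z]. { left. assert (Z : ya' = 0) by lra. pose proof (lo0 xa') as G. rewrite <- Z in G at 1. specialize (G Ha'). unfold u; lra. }
      assert (E : u*(1+N) <= 1+N + ya'*(1-si-N)).
      { pose proof (cross_ge Q p (-k) xa' ya' 0 _ cQ lo0 qB Ha' ltac:(lra) ltac:(lra)). unfold u, N, si; lra. }
      destruct (Rle_dec (1-si-N) 0) as [l1|l1].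
      + left. apply Rmult_le_reg_r with (1+N); [lra|].
        assert (0 <= ya'*-(1-si-N)) by (apply Rmult_le_pos; lra). lra.
      + destruct (Rle_dec ya' 1) as [l2|l2].
        * right; left. assert (0 <= (1-ya')*(1-si-N)) by (apply Rmult_le_pos; lra). lra.
        * right; left.
          assert (F : u*(2+N) <= 2+2*N-(1-si)+ya'*(1-si-N)).
          { pose proof (cross_ge Q p (-k) xa' ya' 1 _ cQ lo1 qB Ha' ltac:(lra) ltac:(lra)). unfold u, N, si; lra. }
          assert (0 <= (1+M-ya')*(1-si-N)) by (apply Rmult_le_pos; unfold M; lra).
          assert (u*(2+N) <= 2+N + M*(1-si-N)) by lra.
          assert (0 <= (1-si-N)*(2+N-M*(1+N))) by (apply Rmult_le_pos; lra).
          assert (u*(2+N)*(1+N) <= (2+N + M*(1-si-N))*(1+N)) by (apply Rmult_le_compat_r; lra).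
          apply Rmult_le_reg_r with (2+N); lra.
    - assert (E : u*(1+M) <= 1+M - ya'*(1-ta-M)).
      { pose proof (cross_ge Q xa' ya' t h 0 _ cQ lo0 Ha' qT ltac:(lra) ltac:(lra)). unfold u, M, ta; lra. }
      destruct (Rle_dec (1-ta-M) 0) as [l1|l1].
      + left. apply Rmult_le_reg_r with (1+M); [lra|].
        assert (0 <= ya'*(1-ta-M)) by nra. lra.
      + destruct (Rle_dec (-1) ya') as [l2|l2].
        * right; right. assert (0 <= (1+ya')*(1-ta-M)) by (apply Rmult_le_pos; lra). lra.
        * right; right.
          assert (F : u*(2+M) <= 2+2*M-(1-ta)-ya'*(1-ta-M)).
          { pose proof (cross_ge Q xa' ya' t h (-1) _ cQ lo2 Ha' qT ltac:(lra) ltac:(lra)) as G. rewrite Hb in G. unfold u, M, ta; lra. }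
          assert (0 <= (1+N+ya')*(1-ta-M)) by (apply Rmult_le_pos; unfold N; lra).
          assert (u*(2+M) <= 2+M + N*(1-ta-M)) by lra.
          assert (0 <= (1-ta-M)*(2+M-N*(1+M))) by (apply Rmult_le_pos; lra).
          assert (u*(2+M)*(1+M) <= (2+M + N*(1-ta-M))*(1+M)) by (apply Rmult_le_compat_r; lra).
          apply Rmult_le_reg_r with (2+M); lra. }
  assert (W : 7/3 <= r + u) by (unfold r, u; lra).
  assert (Y : 1 <= N*(1+2*M)) by nra.
  assert (ts : ta + si <= 1).
  { assert (0 <= si*(M-N)) by (apply Rmult_le_pos; lra).
    apply Rmult_le_reg_r with (1+N); lra. }
  assert (r1 : ta/(2*M) + si/(2*N) <= 1).
  { replace (ta/(2*M) + si/(2*N)) with ((ta*N+si*M)/(2*(M*N))) by (field; lra).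
    apply Rle_div_l; [nra|].
    assert (0 <= ta*(M-N)) by (apply Rmult_le_pos; lra).
    assert (0 <= M*(2*(1-M*N) - (ta*(1+N) + si*(1+M)))) by (apply Rmult_le_pos; lra).
    assert (0 <= M*(N*(1+2*M)-1)) by (apply Rmult_le_pos; lra).
    apply Rmult_le_reg_r with (1+M); lra. }
  (* The three cases bound r + u by 2, 9/4 and 11/5, all below 7/3. *)
  destruct Hu as [Hu|[Hu|Hu]].
  - lra.
  - assert (T1 : ta/(2*M) <= 3/4*ta) by (apply Rle_div_l; [lra|]; assert (0 <= ta*(M-2/3)) by (apply Rmult_le_pos; lra); lra).
    assert (S1 : si/(2*N) + u <= 3/2 + 3/4*si); [|lra].
    assert (v0 : 0 <= si/(2*N)) by (apply Rdiv_le_0_compat; lra).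
    assert (sv : si = 2*N*(si/(2*N))) by (field; lra).
    set (v := si/(2*N)) in *. rewrite sv in Hu |- *.
    assert (0 <= 3*N*(1+N) - 2*(1-N)) by nra.
    assert (0 <= v*(3*N*(1+N) - 2*(1-N))) by (apply Rmult_le_pos; lra).
    apply Rmult_le_reg_r with (1+N); lra.
  - assert (2/3 <= M) by lra. assert (u <= 6/5) by nra. lra.
Qed.
End lower.
End cases.

(** * The extremal triangle *)

Lemma Tri_iff x y : Tri (x,y) <-> y <= 2*x+1 /\ x + y <= 2 /\ x <= 2 + 2*y.
Proof.
  unfold Tri, conv, vtx3. simpl. split.
  - intros (l & H0 & H1 & H2 & H3).
    pose proof (H0 0%nat ltac:(lia)). pose proof (H0 1%nat ltac:(lia)). pose proof (H0 2%nat ltac:(lia)).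
    lra.
  - intros (H1 & H2 & H3).
    (* The barycentric coordinates are the slacks of the three inequalities divided by 5. *)
    exists (fun i => match i with O => (2+2*y-x)/5 | 1%nat => (2-x-y)/5 | _ => (2*x+1-y)/5 end).
    repeat split; try lra.
    intros [|[|i]] _; lra.
Qed.

Lemma convex3 Q x1 y1 x2 y2 x3 y3 a b : convexset Q -> Q (x1,y1) -> Q (x2,y2) -> Q (x3,y3) ->
  0 <= a -> 0 <= b -> a + b <= 1 -> Q (a*x1 + b*x2 + (1-a-b)*x3, a*y1 + b*y2 + (1-a-b)*y3).
Proof.
  intros cQ H1 H2 H3 Ha Hb Hab.
  destruct (Req_dec (a+b) 0) as [e|e].
  { replace a with 0 by lra. replace b with 0 by lra.
    match goal with |- Q ?p => replace p with (x3,y3) by (f_equal; ring) end. assumption. }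
  assert (Hl : 0 <= b/(a+b) <= 1) by (split; [apply Rdiv_le_0_compat | apply Rle_div_l]; lra).
  pose proof (cQ _ _ _ _ _ H3 (cQ _ _ _ _ _ H1 H2 Hl) (conj (Rplus_le_le_0_compat _ _ Ha Hb) Hab)) as H.
  match type of H with Q ?q => match goal with |- Q ?p => replace p with q by (f_equal; field; assumption) end end.
  assumption.
Qed.

(** The sides of the triangle pass through the slice endpoints (0,1) and (-1,-1), (1,1), and (0,-1).
    A point of [Q] beyond a side, joined to a suitable vertex, would cross a row outside its
    slice. *)
Lemma is_Tri Q : convexset Q -> Q (0,0) -> Q (1,0) ->
  (forall x, Q (x,1) -> 0 <= x) -> (forall x, Q (x,1) -> x <= 1) ->
  (forall x, Q (x,-1) -> -1 <= x) -> (forall x, Q (x,-1) -> x <= 0) ->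
  Q (1/3,5/3) -> Q (-4/3,-5/3) -> Q (2,0) -> forall z, Tri z <-> Q z.
Proof.
  intros cQ q0 q1 lo1 hi1 lo2 hi2 qT qA qC [x y]. rewrite Tri_iff. split.
  - intros (H1 & H2 & H3).
    set (a := (2+2*y-x)/5). set (b := (2-x-y)/5).
    replace (x,y) with (a*(1/3) + b*(-4/3) + (1-a-b)*2, a*(5/3) + b*(-5/3) + (1-a-b)*0)
      by (unfold a, b; f_equal; field).
    apply convex3; unfold a, b; try assumption; lra.
  - intros H.
    destruct (Rle_dec y 1) as [l|l].
    + pose proof (cross_ge Q x y _ _ 1 _ cQ lo1 H qT ltac:(lra) ltac:(lra)).
      pose proof (cross_le Q x y _ _ 1 _ cQ hi1 H qT ltac:(lra) ltac:(lra)).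
      destruct (Rle_dec (-1) y) as [l'|l'].
      * pose proof (cross_le Q _ _ x y (-1) _ cQ hi2 qA H ltac:(lra) ltac:(lra)). lra.
      * pose proof (cross_le Q x y _ _ (-1) _ cQ hi2 H qC ltac:(lra) ltac:(lra)). lra.
    + pose proof (cross_ge Q _ _ x y 1 _ cQ lo1 qA H ltac:(lra) ltac:(lra)).
      pose proof (cross_le Q _ _ x y 1 _ cQ hi1 qC H ltac:(lra) ltac:(lra)). lra.
Qed.

(** * Unimodular changes of coordinates and interiors *)

Definition pull (S : unimod) (Q : rset) : rset := fun z => Q (apply_unimod S z).

Lemma unimod_inverse (S : unimod) : exists S', forall z,
  apply_unimod S (apply_unimod S' z) = z /\ apply_unimod S' (apply_unimod S z) = z.
Proof.
  destruct S as [a b c d e f H].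
  (* The determinant g is its own inverse, so g times the adjugate is the inverse matrix. *)
  set (g := (a*d-b*c)%Z).
  assert (g1 : (g*g = 1)%Z) by (unfold g; destruct H as [-> | ->]; reflexivity).
  assert (H' : (g*d * (g*a) - (-g*b) * (-g*c) = 1 \/ g*d * (g*a) - (-g*b) * (-g*c) = -1)%Z).
  { replace (g*d * (g*a) - (-g*b) * (-g*c))%Z with (g*g*g)%Z by (unfold g at 3; ring).
    rewrite g1, Z.mul_1_l. exact H. }
  exists (Unimod (g*d) (-g*b) (-g*c) (g*a) (-(g*d*e-g*b*f)) (-(-g*c*e+g*a*f)) H').
  assert (gR : IZR g * IZR g = 1) by (rewrite <-mult_IZR; now f_equal).
  assert (gE : IZR g = IZR a * IZR d - IZR b * IZR c) by (unfold g; now rewrite minus_IZR, !mult_IZR).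
  intros [x y]; unfold apply_unimod; simpl.
  repeat rewrite ?opp_IZR, ?plus_IZR, ?minus_IZR, ?mult_IZR.
  clearbody g. split; f_equal; nsatz.
Qed.

Lemma unimod_comp (S1 S2 : unimod) : exists S, forall z,
  apply_unimod S z = apply_unimod S1 (apply_unimod S2 z).
Proof.
  destruct S1 as [a b c d e f H], S2 as [a' b' c' d' e' f' H'].
  assert (H'' : ((a*a'+b*c')*(c*b'+d*d') - (a*b'+b*d')*(c*a'+d*c') = 1 \/
                 (a*a'+b*c')*(c*b'+d*d') - (a*b'+b*d')*(c*a'+d*c') = -1)%Z).
  { replace ((a*a'+b*c')*(c*b'+d*d') - (a*b'+b*d')*(c*a'+d*c'))%Z
      with ((a*d-b*c)*(a'*d'-b'*c'))%Z by ring.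
    destruct H as [-> | ->], H' as [-> | ->]; auto. }
  exists (Unimod _ _ _ _ (a*e'+b*f'+e) (c*e'+d*f'+f) H'').
  intros [x y]; unfold apply_unimod; simpl.
  repeat rewrite ?plus_IZR, ?mult_IZR. f_equal; ring.
Qed.

Lemma unimod_lipschitz (S : unimod) : exists C, 0 < C /\ forall z w,
  (fst (apply_unimod S z) - fst (apply_unimod S w))^2 + (snd (apply_unimod S z) - snd (apply_unimod S w))^2
  <= C^2 * ((fst z - fst w)^2 + (snd z - snd w)^2).
Proof.
  destruct S as [a b c d e f H].
  (* This is the squared Frobenius norm; n <= (1+n)^2 makes 1 + n a Lipschitz constant without a
     square root. *)
  set (n := IZR a^2 + IZR b^2 + IZR c^2 + IZR d^2).
  assert (0 <= n) by (unfold n; pose proof (pow2_ge_0 (IZR a)); pose proof (pow2_ge_0 (IZR b));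
    pose proof (pow2_ge_0 (IZR c)); pose proof (pow2_ge_0 (IZR d)); lra).
  exists (1 + n). split; [lra|].
  intros [x y] [x' y']; unfold apply_unimod; simpl fst; simpl snd; simpl m11; simpl m12; simpl m21; simpl m22; simpl b1; simpl b2.
  apply Rle_trans with (n * ((x-x')^2 + (y-y')^2)).
  - apply Rminus_le_0. unfold n.
    apply Rle_trans with ((IZR a * (y-y') - IZR b * (x-x'))^2 + (IZR c * (y-y') - IZR d * (x-x'))^2);
      [pose proof (pow2_ge_0 (IZR a * (y-y') - IZR b * (x-x')));
       pose proof (pow2_ge_0 (IZR c * (y-y') - IZR d * (x-x'))); lra|].
    right. ring.
  - apply Rmult_le_compat_r; [|nra].
    pose proof (pow2_ge_0 (x-x')); pose proof (pow2_ge_0 (y-y')); lra.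
Qed.

Lemma interior_ext Q Q' z : (forall w, Q w <-> Q' w) -> pinterior Q z -> pinterior Q' z.
Proof. intros H (e & He & HQ). exists e. split; [assumption|]. intros y Hy. now apply H, HQ. Qed.

Lemma interior_in Q z : pinterior Q z -> Q z.
Proof. intros (e & He & HQ). apply HQ. pose proof (pow_lt e 2 He). lra. Qed.

Lemma interior_to_pull S Q z : pinterior Q (apply_unimod S z) -> pinterior (pull S Q) z.
Proof.
  intros (e & He & HQ). destruct (unimod_lipschitz S) as (C & HC & L).
  exists (e / C). split; [now apply Rdiv_lt_0_compat|].
  intros y Hy. apply HQ. eapply Rle_lt_trans; [apply L|].
  replace (e^2) with (C^2 * (e/C)^2) by (field; lra).
  apply Rmult_lt_compat_l; [now apply pow_lt|assumption].
Qed.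

Lemma interior_of_pull S Q z : pinterior (pull S Q) z -> pinterior Q (apply_unimod S z).
Proof.
  intros H. destruct (unimod_inverse S) as (S' & HS).
  apply interior_ext with (pull S' (pull S Q)).
  - intros w. unfold pull. now rewrite (proj1 (HS w)).
  - apply interior_to_pull. now rewrite (proj2 (HS z)).
Qed.

(** The homothety of ratio l centred at (x1,y1) maps a disc around (x2,y2) to a disc that stays in
    [Q]. *)
Lemma interior_between Q x1 y1 x2 y2 l : convexset Q -> Q (x1,y1) -> pinterior Q (x2,y2) ->
  0 < l <= 1 -> pinterior Q ((1-l)*x1 + l*x2, (1-l)*y1 + l*y2).
Proof.
  intros cQ H1 (e & He & H2) Hl.
  exists (l*e). split; [nra|]. intros [x y]; simpl fst; simpl snd. intros H.
  pose (x' := x2 + (x - ((1-l)*x1 + l*x2))/l). pose (y' := y2 + (y - ((1-l)*y1 + l*y2))/l).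
  replace (x,y) with ((1-l)*x1 + l*x', (1-l)*y1 + l*y') by (unfold x', y'; f_equal; field; lra).
  apply cQ; [assumption| |lra].
  apply H2. simpl fst; simpl snd. unfold x', y'.
  apply Rmult_lt_reg_l with (l^2); [apply pow_lt; lra|].
  eapply Rle_lt_trans; [|eapply Rlt_le_trans; [exact H|]]; right; field; lra.
Qed.

(** * Wide and admissible sets *)

Definition lin (u1 u2 : Z) (z : pt) : R := IZR u1 * fst z + IZR u2 * snd z.

(** The extrema are required to be attained, as they are on a polygon. *)
Definition wide (Q : rset) : Prop := forall u1 u2, (u1,u2) <> (0%Z,0%Z) ->
  exists X Y, Q X /\ Q Y /\ (forall Z, Q Z -> lin u1 u2 Y <= lin u1 u2 Z <= lin u1 u2 X) /\
    10/3 <= lin u1 u2 X - lin u1 u2 Y.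

(** The middle condition is freeness, stated on the three vertices so that it pulls back under
    unimodular maps. *)
Definition adm (Q : rset) : Prop := convexset Q /\
  (forall S, ~ (pinterior Q (apply_unimod S (0,0)) /\ pinterior Q (apply_unimod S (1,0)) /\
                pinterior Q (apply_unimod S (0,1)))) /\ wide Q.

Lemma lin_unimod (S : unimod) u1 u2 : (u1,u2) <> (0%Z,0%Z) ->
  exists v1 v2 c, (v1,v2) <> (0%Z,0%Z) /\ forall z, lin v1 v2 z = lin u1 u2 (apply_unimod S z) + c.
Proof.
  intros Hu.
  pose (v1 := (u1 * m11 S + u2 * m21 S)%Z). pose (v2 := (u1 * m12 S + u2 * m22 S)%Z).
  exists v1, v2, (-(IZR u1 * IZR (b1 S) + IZR u2 * IZR (b2 S))).
  split.
  - intros E. apply Hu. injection E as E1 E2. unfold v1, v2 in *.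
    pose proof (unimod_det S) as D.
    set (a := m11 S) in *. set (b := m12 S) in *. set (c := m21 S) in *. set (d := m22 S) in *.
    assert (F1 : (u1 * (a*d-b*c) = 0)%Z) by (transitivity ((u1*a+u2*c)*d - (u1*b+u2*d)*c)%Z; [ring|rewrite E1, E2; ring]).
    assert (F2 : (u2 * (a*d-b*c) = 0)%Z) by (transitivity ((u1*b+u2*d)*a - (u1*a+u2*c)*b)%Z; [ring|rewrite E1, E2; ring]).
    f_equal; destruct D as [D|D]; rewrite D in F1, F2; lia.
  - intros [x y]. unfold lin, v1, v2, apply_unimod; simpl.
    rewrite !plus_IZR, !mult_IZR. ring.
Qed.

Lemma wide_pull S Q : wide Q -> wide (pull S Q).
Proof.
  intros HQ u1 u2 Hu. destruct (unimod_inverse S) as (S' & HS).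
  destruct (lin_unimod S' u1 u2 Hu) as (v1 & v2 & c & Hv & Hlin).
  destruct (HQ v1 v2 Hv) as (X & Y & HX & HY & HXY & Hw).
  exists (apply_unimod S' X), (apply_unimod S' Y).
  unfold pull. rewrite !(fun z => proj1 (HS z)).
  rewrite !Hlin in Hw. repeat split; try assumption; try lra.
  - specialize (HXY _ H). rewrite !Hlin, (proj2 (HS _)) in HXY. lra.
  - specialize (HXY _ H). rewrite !Hlin, (proj2 (HS _)) in HXY. lra.
Qed.

Lemma convex_pull S Q : convexset Q -> convexset (pull S Q).
Proof.
  intros cQ x1 y1 x2 y2 l H1 H2 Hl. unfold pull, apply_unimod in *. simpl in *.
  pose proof (cQ _ _ _ _ l H1 H2 Hl) as H.
  match type of H with Q ?q => match goal with |- Q ?p => replace p with q by (f_equal; ring) end end.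
  assumption.
Qed.

Lemma adm_pull S Q : adm Q -> adm (pull S Q).
Proof.
  intros (cQ & fQ & wQ). split; [now apply convex_pull|split; [|now apply wide_pull]].
  intros S' (H1 & H2 & H3). destruct (unimod_comp S S') as (S'' & HS).
  apply (fQ S''). rewrite !HS. repeat split; now apply interior_of_pull.
Qed.

(** * Slices of an admissible set in the rows y = 1 and y = -1 *)

Section levels.
Variable Q : rset.
Hypotheses (aQ : adm Q) (i0 : pinterior Q (0,0)) (i1 : pinterior Q (1,0)).

(** For s = 1 or s = -1, the points (0,0), (1,0) and (m,s) span a unimodular triangle. *)
Lemma no_lattice_point (m s : Z) : (s = 1 \/ s = -1)%Z -> ~ pinterior Q (IZR m, IZR s).
Proof.
  intros Hs H. destruct aQ as (_ & fQ & _).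
  assert (D : (1 * s - m * 0 = 1 \/ 1 * s - m * 0 = -1)%Z) by lia.
  apply (fQ (Unimod 1 m 0 s 0 0 D)). unfold apply_unimod; simpl.
  repeat split.
  - replace (_,_) with (0,0); [assumption|f_equal; ring].
  - replace (_,_) with (1,0); [assumption|f_equal; ring].
  - replace (_,_) with (IZR m, IZR s); [assumption|f_equal; ring].
Qed.

(** The segment from (0,0) to a point beyond the row contains an interior point of that row. A slice
    reaching past a lattice point would make that lattice point interior. *)
Lemma level_bounds (s : Z) x y : (s = 1 \/ s = -1)%Z -> Q (x,y) -> 1 < IZR s * y ->
  exists a : Z, forall x', Q (x', IZR s) -> IZR a <= x' <= IZR a + 1.
Proof.
  intros Hs HQ Hy. pose proof (proj1 aQ) as cQ.
  pose (l := 1 - 1/(IZR s * y)).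
  assert (s2 : IZR s * IZR s = 1) by (destruct Hs as [-> | ->]; ring).
  assert (y0 : y <> 0) by (intros ->; lra).
  assert (Hl : 0 < l <= 1).
  { unfold l. assert (1/(IZR s*y) < 1) by (apply Rlt_div_l; lra).
    assert (0 < 1/(IZR s*y)) by (apply Rdiv_lt_0_compat; lra). lra. }
  pose proof (interior_between Q x y 0 0 l cQ HQ i0 Hl) as I.
  set (x0 := (1-l)*x + l*0) in *.
  replace ((1-l)*y + l*0) with (IZR s) in I
    by (unfold l; destruct Hs as [-> | ->]; field; assumption).
  (* [up x0] is the least integer above [x0], so the witness is the floor of [x0]. *)
  clearbody x0. exists (up x0 - 1)%Z. destruct (archimed x0) as [A1 A2].
  rewrite minus_IZR. intros x' Hx'.
  assert (B : forall m, x' < IZR m <= x0 \/ x0 <= IZR m < x' -> False).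
  { intros m Hm. apply (no_lattice_point m s Hs).
    pose (l' := (IZR m - x')/(x0 - x')).
    assert (Hl' : 0 < l' <= 1).
    { unfold l'. destruct Hm.
      - split; [apply Rdiv_lt_0_compat; lra| apply Rle_div_l; lra].
      - replace ((IZR m - x')/(x0 - x')) with ((x'-IZR m)/(x'-x0)) by (field; lra).
        split; [apply Rdiv_lt_0_compat; lra| apply Rle_div_l; lra]. }
    pose proof (interior_between Q _ _ _ _ l' cQ Hx' I Hl') as J.
    match type of J with pinterior _ ?q => replace q with (IZR m, IZR s) in J end; [assumption|].
    unfold l'; f_equal; field; lra. }
  split.
  - apply Rnot_lt_le. intro. apply (B (up x0 - 1)%Z). rewrite minus_IZR. lra.
  - apply Rnot_lt_le. intro. apply (B (up x0)). lra.
Qed.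
End levels.

(** * Reduction to normal position *)

Definition is_tri (Q : rset) : Prop := exists S, forall z, Tri z <-> Q (apply_unimod S z).

Lemma is_tri_pull S Q : is_tri (pull S Q) -> is_tri Q.
Proof.
  intros (S' & H). destruct (unimod_comp S S') as (S'' & HS). exists S''.
  intros z. rewrite HS. apply H.
Qed.

Lemma wide_01 Q : wide Q -> exists t h p k, Q (t,h) /\ Q (p,-k) /\
  (forall x y, Q (x,y) -> -k <= y <= h) /\ 10/3 <= h + k.
Proof.
  intros H. destruct (H 0%Z 1%Z ltac:(congruence)) as ([t h] & [p k] & HX & HY & HXY & Hw).
  unfold lin in *. simpl in *. exists t, h, p, (-k). rewrite Ropp_involutive.
  repeat split; try assumption; try lra; specialize (HXY _ H0); simpl in HXY; lra.
Qed.

Lemma wide_10 Q : wide Q -> exists xa ya xc yc, Q (xa,ya) /\ Q (xc,yc) /\ 10/3 <= xc - xa.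
Proof.
  intros H. destruct (H 1%Z 0%Z ltac:(congruence)) as ([xc yc] & [xa ya] & HX & HY & HXY & Hw).
  unfold lin in Hw. simpl in Hw. exists xa, ya, xc, yc. repeat split; try assumption; lra.
Qed.

Lemma wide_1m1 Q : wide Q -> exists xa ya xc yc, Q (xa,ya) /\ Q (xc,yc) /\ 10/3 <= (xc - yc) - (xa - ya).
Proof.
  intros H. destruct (H 1%Z (-1)%Z ltac:(congruence)) as ([xc yc] & [xa ya] & HX & HY & HXY & Hw).
  unfold lin in Hw. simpl in Hw. exists xa, ya, xc, yc. repeat split; try assumption; lra.
Qed.

Lemma level_zero Q : convexset Q -> pinterior Q (0,0) -> ~ pinterior Q (-1,0) -> forall x, Q (x,0) -> -1 <= x.
Proof.
  intros cQ i0 im x H. apply Rnot_lt_le. intro. apply im.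
  pose proof (interior_between Q _ _ _ _ ((-1-x)/(0-x)) cQ H i0) as J.
  match type of J with _ -> pinterior _ ?q => replace q with (-1, 0) in J by (f_equal; field; lra) end.
  apply J. split; [apply Rdiv_lt_0_compat; lra| apply Rle_div_l; lra].
Qed.

Ltac pull_coords := unfold pull, apply_unimod; simpl.
Ltac pull_interior H := apply interior_to_pull; unfold apply_unimod; simpl;
  match type of H with pinterior _ ?p => match goal with |- pinterior _ ?q =>
    replace q with p by (f_equal; ring) end end; exact H.

Lemma shear_left_det : (1 * 1 - 1 * 0 = 1 \/ 1 * 1 - 1 * 0 = -1)%Z. Proof. now left. Qed.

(** Strong induction on n = -b: passing to the pair (-1,0), (0,0) lowers n by 2. *)
Lemma is_tri_of_rows (n : nat) : forall Q h k t p, adm Q -> pinterior Q (0,0) -> pinterior Q (1,0) ->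
  (forall x, Q (x,1) -> 0 <= x <= 1) -> Q (t,h) -> Q (p,-k) ->
  (forall x y, Q (x,y) -> -k <= y <= h) -> k <= h -> 10/3 <= h + k -> 1 < k ->
  (forall x, Q (x,-1) -> - INR n <= x <= - INR n + 1) -> is_tri Q.
Proof.
  induction n as [n IH] using (well_founded_induction Wf_nat.lt_wf).
  intros Q h k t p aQ i0 i1 l1 qT qB rng kh hk k1 l2.
  destruct aQ as (cQ & fQ & wQ).
  pose proof (interior_in _ _ i0) as q0. pose proof (interior_in _ _ i1) as q1.
  assert (lo1 : forall x, Q (x,1) -> 0 <= x) by (intros; now apply l1).
  assert (hi1 : forall x, Q (x,1) -> x <= 1) by (intros; now apply l1).
  assert (lo2 : forall x, Q (x,-1) -> - INR n <= x) by (intros; now apply l2).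
  assert (hi2 : forall x, Q (x,-1) -> x <= - INR n + 1) by (intros; now apply l2).
  destruct (wide_10 Q wQ) as (xa & ya & xc & yc & Ha & Hc & Hw).
  destruct n as [|[|n]].
  - exfalso. eapply (offset_0_narrow Q h k t p) with (b := - INR 0) (xa := xa) (xc := xc); try eassumption. simpl; ring.
  - destruct (offset_m1_extremal Q h k t p cQ q0 q1 lo1 hi1 qT qB rng kh hk (- INR 1) k1 lo2 hi2 xa ya xc yc
      ltac:(simpl; ring) Ha Hc Hw) as (eh & ek & et & E1 & E2).
    rewrite E1 in Ha. rewrite E2 in Hc. rewrite eh, et in qT. simpl in lo2, hi2.
    exists (Unimod 1 0 0 1 0 0 (or_introl eq_refl)). intros [x y].
    replace (apply_unimod _ _) with (x,y) by (unfold apply_unimod; simpl; f_equal; ring).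
    apply is_Tri; try assumption. intros x' Hx'. specialize (hi2 _ Hx'). lra.
  - rewrite !S_INR in *. pose proof (pos_INR n) as n0.
    destruct (Classical_Prop.classic (pinterior Q (-1,0))) as [im|im].
    (* The shear (x+y-1, y) sends (0,0), (1,0) to (-1,0), (0,0), fixes the row y = 1 and moves the
       row y = -1 by 2 to the left. *)
    + set (S := Unimod 1 1 0 1 (-1) 0 shear_left_det).
      apply (is_tri_pull S).
      apply (IH n ltac:(lia) _ h k (t+1-h) (p+1+k)); try assumption.
      * apply adm_pull. now split.
      * pull_interior im.
      * pull_interior i0.
      * intros x H. pose proof (l1 (x-1+1)). unfold pull, apply_unimod in H; simpl in H.
        match type of H with Q ?q => replace q with (x-1+1,1) in H by (f_equal; ring) end.
        specialize (H0 H). lra.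
      * pull_coords. match goal with |- Q ?q => replace q with (t,h) by (f_equal; ring) end. assumption.
      * pull_coords. match goal with |- Q ?q => replace q with (p,-k) by (f_equal; ring) end. assumption.
      * intros x y H. unfold pull, apply_unimod in H; simpl in H. apply rng in H. lra.
      * intros x H. unfold pull, apply_unimod in H; simpl in H.
        match type of H with Q ?q => replace q with (x-2,-1) in H by (f_equal; ring) end.
        apply l2 in H. lra.
    + exfalso. pose proof (level_zero Q cQ i0 im) as lo0.
      destruct n as [|n].
      * destruct (wide_1m1 Q wQ) as (xa' & ya' & xc' & yc' & Ha' & Hc' & Hw').
        eapply (offset_m2_narrow Q h k t p) with (b := - (INR 0 + 1 + 1)) (xa := xa) (xc := xc) (xa' := xa') (xc' := xc'); try eassumption.
        simpl; ring.
      * eapply (offset_le_m3_absurd Q h k t p) with (b := - (INR (S n) + 1 + 1)); try eassumption.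
        rewrite S_INR in *. pose proof (pos_INR n). lra.
Qed.

Lemma is_tri_of_upper_row Q h k t p : adm Q -> pinterior Q (0,0) -> pinterior Q (1,0) ->
  (forall x, Q (x,1) -> 0 <= x <= 1) -> Q (t,h) -> Q (p,-k) ->
  (forall x y, Q (x,y) -> -k <= y <= h) -> k <= h -> 10/3 <= h + k -> is_tri Q.
Proof.
  intros aQ i0 i1 l1 qT qB rng kh hk.
  destruct (Rle_dec k 1) as [k1|k1].
  { exfalso. destruct aQ as (cQ & fQ & wQ).
    destruct (wide_10 Q wQ) as (xa & ya & xc & yc & Ha & Hc & Hw).
    eapply (thin_below Q h k t) with (xa := xa) (xc := xc); try eassumption; try (now apply interior_in);
    intros; now apply l1. }
  destruct (level_bounds Q aQ i0 i1 (-1) p (-k)) as (a & Hl2); [now right|assumption|lra|].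
  destruct (Z_le_dec a 0) as [l|l].
  - apply (is_tri_of_rows (Z.to_nat (-a)) Q h k t p); try assumption; [lra|].
    rewrite INR_IZR_INZ, Z2Nat.id, opp_IZR, Ropp_involutive by lia. assumption.
  - assert (D : (-1 * 1 - 0 * 0 = 1 \/ -1 * 1 - 0 * 0 = -1)%Z) by now right.
    (* The reflection x -> 1 - x swaps (0,0) and (1,0), preserves [0,1] in the row y = 1 and turns
       the offset a into -a. *)
    set (S := Unimod (-1) 0 0 1 1 0 D).
    assert (e : forall x y, pull S Q (x,y) <-> Q (1-x,y)).
    { intros x y. unfold pull, apply_unimod; simpl.
      match goal with |- Q ?q <-> _ => replace q with (1-x,y) by (f_equal; ring) end. tauto. }
    apply (is_tri_pull S).
    apply (is_tri_of_rows (Z.to_nat a) _ h k (1-t) (1-p)); try assumption.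
    + now apply adm_pull.
    + pull_interior i1.
    + pull_interior i0.
    + intros x H. apply e, l1 in H. lra.
    + apply e. match goal with |- Q ?q => replace q with (t,h) by (f_equal; ring) end. assumption.
    + apply e. match goal with |- Q ?q => replace q with (p,-k) by (f_equal; ring) end. assumption.
    + intros x y H. apply e, rng in H. lra.
    + lra.
    + rewrite INR_IZR_INZ, Z2Nat.id by lia. intros x H. apply e, Hl2 in H. lra.
Qed.

Lemma is_tri_of_tall_top Q h k t p : adm Q -> pinterior Q (0,0) -> pinterior Q (1,0) ->
  Q (t,h) -> Q (p,-k) ->
  (forall x y, Q (x,y) -> -k <= y <= h) -> k <= h -> 10/3 <= h + k -> is_tri Q.
Proof.
  intros aQ i0 i1 qT qB rng kh hk.
  destruct (level_bounds Q aQ i0 i1 1 t h) as (a & Hl1); [now left|assumption|lra|].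
  assert (D : (1 * 1 - a * 0 = 1 \/ 1 * 1 - a * 0 = -1)%Z) by (left; ring).
  (* This shear fixes the row y = 0 and brings the slice [a,a+1] of the row y = 1 to [0,1]. *)
  set (S := Unimod 1 a 0 1 0 0 D).
  assert (e : forall x y, pull S Q (x,y) <-> Q (x + IZR a * y,y)).
  { intros x y. unfold pull, apply_unimod; simpl.
    match goal with |- Q ?q <-> _ => replace q with (x + IZR a * y,y) by (f_equal; ring) end. tauto. }
  apply (is_tri_pull S).
  apply (is_tri_of_upper_row _ h k (t - IZR a * h) (p + IZR a * k)); try assumption.
  - now apply adm_pull.
  - pull_interior i0.
  - pull_interior i1.
  - intros x H. apply e, Hl1 in H. lra.
  - apply e. match goal with |- Q ?q => replace q with (t,h) by (f_equal; ring) end. assumption.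
  - apply e. match goal with |- Q ?q => replace q with (p,-k) by (f_equal; ring) end. assumption.
  - intros x y H. apply e, rng in H. lra.
Qed.

Lemma is_tri_of_unit_pair Q : adm Q -> pinterior Q (0,0) -> pinterior Q (1,0) -> is_tri Q.
Proof.
  intros aQ i0 i1.
  destruct (wide_01 Q (proj2 (proj2 aQ))) as (t & h & p & k & qT & qB & rng & hk).
  destruct (Rle_dec k h) as [l|l]; [now apply (is_tri_of_tall_top Q h k t p)|].
  assert (D : (1 * -1 - 0 * 0 = 1 \/ 1 * -1 - 0 * 0 = -1)%Z) by now right.
  set (S := Unimod 1 0 0 (-1) 0 0 D).
  assert (e : forall x y, pull S Q (x,y) <-> Q (x,-y)).
  { intros x y. unfold pull, apply_unimod; simpl.
    match goal with |- Q ?q <-> _ => replace q with (x,-y) by (f_equal; ring) end. tauto. }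
  apply (is_tri_pull S).
  apply (is_tri_of_tall_top _ k h p t); try lra.
  - now apply adm_pull.
  - pull_interior i0.
  - pull_interior i1.
  - now apply e.
  - apply e. now rewrite Ropp_involutive.
  - intros x y H. apply e, rng in H. lra.
Qed.

(** The first lattice point after [z1] on the segment to [z2] is interior, and Bezout coefficients
    complete the primitive vector (a,c) to a unimodular matrix. *)
Lemma is_tri_of_lattice_pair Q z1 z2 : adm Q -> z1 <> z2 -> pinterior Q (zpt z1) -> pinterior Q (zpt z2) -> is_tri Q.
Proof.
  intros aQ Hz I1 I2. destruct z1 as [x1 y1], z2 as [x2 y2].
  unfold zpt in *; simpl in I1, I2.
  set (g := Z.gcd (x2-x1) (y2-y1)).
  assert (g0 : (0 < g)%Z).
  { pose proof (Z.gcd_nonneg (x2-x1) (y2-y1)). assert (g <> 0%Z); [|unfold g in *; lia].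
    intros E. pose proof (Z.gcd_eq_0_l _ _ E). pose proof (Z.gcd_eq_0_r _ _ E).
    apply Hz. f_equal; lia. }
  destruct (Z.gcd_divide_l (x2-x1) (y2-y1)) as (a & Ea).
  destruct (Z.gcd_divide_r (x2-x1) (y2-y1)) as (c & Ec). fold g in Ea, Ec.
  destruct (Z.gcd_bezout (x2-x1) (y2-y1) g eq_refl) as (u & v & Huv).
  assert (B : (a*u + c*v = 1)%Z).
  { rewrite Ea, Ec in Huv. apply (Z.mul_reg_r _ _ g); [lia|]. lia. }
  assert (D : (a * u - -v * c = 1 \/ a * u - -v * c = -1)%Z) by (left; lia).
  set (S := Unimod a (-v) c u x1 y1 D).
  apply (is_tri_pull S). apply is_tri_of_unit_pair.
  - now apply adm_pull.
  - pull_interior I1.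
  - apply interior_to_pull. unfold apply_unimod; simpl.
    assert (1 <= IZR g) by (apply (IZR_le 1); lia).
    assert (Hl : 0 < 1/IZR g <= 1) by (split; [apply Rdiv_lt_0_compat; lra|apply Rle_div_l; lra]).
    pose proof (interior_between Q _ _ _ _ (1/IZR g) (proj1 aQ) (interior_in _ _ I1) I2 Hl) as J.
    match type of J with pinterior _ ?p => match goal with |- pinterior _ ?q => replace q with p; [assumption|] end end.
    replace x2 with (x1 + a*g)%Z by lia. replace y2 with (y1 + c*g)%Z by lia.
    rewrite !plus_IZR, !mult_IZR. f_equal; field; lra.
Qed.

(** * Linear functionals on polygons and the lattice width *)

Lemma rsum_ext n f g : (forall i, (i < n)%nat -> f i = g i) -> rsum n f = rsum n g.
Proof.
  induction n as [|n IH]; intros H; simpl; [reflexivity|].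
  rewrite IH, (H n); [reflexivity|lia|intros; apply H; lia].
Qed.

Lemma rsum_le n f g : (forall i, (i < n)%nat -> f i <= g i) -> rsum n f <= rsum n g.
Proof.
  induction n as [|n IH]; intros H; simpl; [lra|].
  apply Rplus_le_compat; [apply IH; intros; apply H; lia|apply H; lia].
Qed.

Lemma rsum_lin n a b f g : rsum n (fun i => a * f i + b * g i) = a * rsum n f + b * rsum n g.
Proof. induction n as [|n IH]; simpl; [ring|rewrite IH; ring]. Qed.

Lemma rsum_single n k f : (k < n)%nat -> rsum n (fun i => (if Nat.eqb i k then 1 else 0) * f i) = f k.
Proof.
  intros Hk.
  assert (Hz : forall m, (m <= k)%nat -> rsum m (fun i => (if Nat.eqb i k then 1 else 0) * f i) = 0).
  { intros m Hm. transitivity (rsum m (fun i => 0 * f i + 0 * f i)); [|rewrite rsum_lin; ring].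
    apply rsum_ext. intros i Hi. destruct (Nat.eqb_spec i k); [lia|ring]. }
  induction n as [|n IH]; [lia|]. simpl.
  destruct (Nat.eqb_spec n k) as [->|H].
  - rewrite Hz by lia. ring.
  - rewrite IH by lia. ring.
Qed.

Lemma conv_convex n v : convexset (conv n v).
Proof.
  intros x1 y1 x2 y2 l (a & a0 & a1 & ax & ay) (b & b0 & b1 & bx & bz) Hl. simpl in *.
  exists (fun i => (1-l) * a i + l * b i). simpl. repeat split.
  - intros i Hi. specialize (a0 i Hi). specialize (b0 i Hi).
    apply Rplus_le_le_0_compat; apply Rmult_le_pos; lra.
  - rewrite rsum_lin, a1, b1. ring.
  - rewrite ax, bx, <- rsum_lin. apply rsum_ext. intros. ring.
  - rewrite ay, bz, <- rsum_lin. apply rsum_ext. intros. ring.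
Qed.

Lemma vertex_in_conv n v k : (k < n)%nat -> conv n v (v k).
Proof.
  intros Hk. exists (fun i => if Nat.eqb i k then 1 else 0). repeat split.
  - intros i _. destruct (Nat.eqb i k); lra.
  - etransitivity; [|exact (rsum_single n k (fun _ => 1) Hk)]. apply rsum_ext. intros. ring.
  - symmetry. exact (rsum_single n k (fun i => fst (v i)) Hk).
  - symmetry. exact (rsum_single n k (fun i => snd (v i)) Hk).
Qed.

Lemma argmax n (f : nat -> R) : (0 < n)%nat -> exists k, (k < n)%nat /\ forall i, (i < n)%nat -> f i <= f k.
Proof.
  induction n as [|[|n] IH]; intros Hn; [lia| |].
  - exists 0%nat. split; [lia|]. intros i Hi. replace i with 0%nat by lia. lra.
  - destruct IH as (k & Hk & HM); [lia|].
    destruct (Rle_dec (f k) (f (S n))).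
    + exists (S n). split; [lia|]. intros i Hi. destruct (Nat.eq_dec i (S n)) as [->|]; [lra|].
      specialize (HM i ltac:(lia)). lra.
    + exists k. split; [lia|]. intros i Hi. destruct (Nat.eq_dec i (S n)) as [->|]; [lra|].
      apply HM; lia.
Qed.

Lemma conv_max n v u1 u2 : (exists z, conv n v z) ->
  exists X, conv n v X /\ forall z, conv n v z -> lin u1 u2 z <= lin u1 u2 X.
Proof.
  intros (z0 & l0 & _ & S0 & _).
  assert (Hn : (0 < n)%nat) by (destruct n; [simpl in S0; lra|lia]).
  destruct (argmax n (fun i => lin u1 u2 (v i)) Hn) as (k & Hk & HM).
  exists (v k). split; [now apply vertex_in_conv|].
  intros z (l & H0 & H1 & Hx & Hy). unfold lin at 1. rewrite Hx, Hy, <- rsum_lin.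
  apply Rle_trans with (rsum n (fun i => lin u1 u2 (v k) * l i + 0 * l i)).
  - apply rsum_le. intros i Hi. specialize (H0 i Hi). specialize (HM i Hi). simpl in HM.
    assert (0 <= l i * (lin u1 u2 (v k) - lin u1 u2 (v i))) by (apply Rmult_le_pos; lra).
    unfold lin in *. lra.
  - rewrite rsum_lin, H1. lra.
Qed.

Lemma conv_extremes n v u1 u2 : (exists z, conv n v z) ->
  exists X Y, conv n v X /\ conv n v Y /\ forall z, conv n v z -> lin u1 u2 Y <= lin u1 u2 z <= lin u1 u2 X.
Proof.
  intros H. destruct (conv_max n v u1 u2 H) as (X & HX & MX).
  destruct (conv_max n v (-u1) (-u2) H) as (Y & HY & MY).
  exists X, Y. repeat split; try assumption; [|now apply MX].
  specialize (MY z H0). unfold lin in *. rewrite !opp_IZR in MY. lra.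
Qed.

Lemma width_dir_extremes P u1 u2 X Y : P X -> P Y ->
  (forall z, P z -> lin u1 u2 Y <= lin u1 u2 z <= lin u1 u2 X) ->
  width_dir P u1 u2 = Finite (lin u1 u2 X - lin u1 u2 Y).
Proof.
  intros HX HY HXY. apply is_lub_Rbar_unique. split.
  - intros d (x & y & Hx & Hy & ->). simpl. fold (lin u1 u2 x) (lin u1 u2 y).
    pose proof (HXY x Hx). pose proof (HXY y Hy). apply Rabs_le. lra.
  - intros b Hb. apply Hb. exists X, Y. repeat split; try assumption.
    fold (lin u1 u2 X) (lin u1 u2 Y). pose proof (HXY X HX). rewrite Rabs_pos_eq; lra.
Qed.

Lemma width_le_extremes P u1 u2 X Y : (u1,u2) <> (0%Z,0%Z) -> P X -> P Y ->
  (forall z, P z -> lin u1 u2 Y <= lin u1 u2 z <= lin u1 u2 X) ->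
  Rbar_le (width P) (Finite (lin u1 u2 X - lin u1 u2 Y)).
Proof.
  intros Hu HX HY HXY. unfold width.
  apply (proj1 (Glb_Rbar_correct _)). exists u1, u2. split; [assumption|now apply width_dir_extremes].
Qed.

Lemma width_ge_of_wide P : wide P -> Rbar_le (Finite (10/3)) (width P).
Proof.
  intros HP. unfold width. apply (proj2 (Glb_Rbar_correct _)).
  intros w (u1 & u2 & Hu & Hw). destruct (HP u1 u2 Hu) as (X & Y & HX & HY & HXY & Hd).
  rewrite (width_dir_extremes P u1 u2 X Y HX HY HXY) in Hw. injection Hw as <-. exact Hd.
Qed.

Lemma wide_of_width_ge P n v : (forall z, P z <-> conv n v z) -> (exists z, P z) ->
  Rbar_le (Finite (10/3)) (width P) -> wide P.
Proof.
  intros HP [z0 Hz] Hw u1 u2 Hu.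
  destruct (conv_extremes n v u1 u2) as (X & Y & HX & HY & HXY); [exists z0; now apply HP|].
  assert (HXY' : forall z, P z -> lin u1 u2 Y <= lin u1 u2 z <= lin u1 u2 X) by (intros; now apply HXY, HP).
  apply HP in HX. apply HP in HY. exists X, Y. repeat split; try assumption; try now apply HXY'.
  exact (Rbar_le_trans _ _ _ Hw (width_le_extremes P u1 u2 X Y Hu HX HY HXY')).
Qed.

(** * The width of the triangle *)

Lemma Tri_vertices : Tri (1/3,5/3) /\ Tri (-4/3,-5/3) /\ Tri (2,0).
Proof. rewrite !Tri_iff. lra. Qed.

Lemma wide_Tri : wide Tri.
Proof.
  intros u1 u2 Hu. destruct Tri_vertices as (H1 & H2 & H3).
  destruct (conv_extremes 3 (vtx3 (1/3, 5/3) (-4/3, -5/3) (2, 0)) u1 u2) as (X & Y & HX & HY & HXY).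
  { exists (2,0). assumption. }
  exists X, Y. repeat split; try assumption; try now apply HXY.
  pose proof (HXY _ H1). pose proof (HXY _ H2). pose proof (HXY _ H3).
  unfold lin in *; simpl in *.
  (* The edge vectors are 5/3 times (1,2), (1,-1) and (2,1) up to sign, so a value of size at least
     2 on one of these gives 10/3. *)
  assert (C : (2 <= u1 + 2*u2 \/ u1 + 2*u2 <= -2 \/ 2 <= u1 - u2 \/ u1 - u2 <= -2 \/
    2 <= 2*u1 + u2 \/ 2*u1+u2 <= -2)%Z).
  { destruct (Z.eq_dec u1 0) as [->|]; [destruct (Z.eq_dec u2 0) as [->|]; [congruence|]|]; lia. }
  destruct C as [C|[C|[C|[C|[C|C]]]]]; apply IZR_le in C;
    rewrite ?plus_IZR, ?minus_IZR, ?mult_IZR in C; lra.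
Qed.

Lemma width_of_is_tri P : is_tri P -> width P = Finite (10/3).
Proof.
  intros (S & HS). destruct (unimod_inverse S) as (S' & HS').
  assert (HP : forall z, P z <-> Tri (apply_unimod S' z)).
  { intros z. rewrite HS, (proj1 (HS' z)). tauto. }
  apply Rbar_le_antisym.
  (* In direction y the triangle has extent exactly 10/3. *)
  - destruct (lin_unimod S' 0 1 ltac:(congruence)) as (v1 & v2 & c & Hv & Hlin).
    destruct Tri_vertices as (H1 & H2 & _).
    pose proof (width_le_extremes P v1 v2 (apply_unimod S (1/3,5/3)) (apply_unimod S (-4/3,-5/3)) Hv) as W.
    rewrite !Hlin, !(proj2 (HS' _)) in W. unfold lin in W; simpl in W.
    replace (10/3) with (0 * (1 / 3) + 1 * (5 / 3) + c - (0 * (-4 / 3) + 1 * (-5 / 3) + c)) by lra.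
    apply W; [now apply HS|now apply HS|].
    intros z Hz. fold (lin v1 v2 z). rewrite Hlin. apply HP in Hz. destruct (apply_unimod S' z) as [x y].
    apply Tri_iff in Hz. unfold lin; simpl. lra.
  - apply width_ge_of_wide. intros u1 u2 Hu.
    destruct (wide_pull S' Tri wide_Tri u1 u2 Hu) as (X & Y & HX & HY & HXY & Hw).
    exists X, Y. repeat split; try (now apply HP); try (now apply HXY, HP). assumption.
Qed.

Lemma is_tri_iff P : is_tri P <-> unimod_equiv P Tri.
Proof.
  split; intros (S & HS); destruct (unimod_inverse S) as (S' & HS'); exists S'; intros z.
  - rewrite HS. split.
    + intros H. exists (apply_unimod S z). split; [assumption|now rewrite (proj2 (HS' z))].
    + intros (x & Hx & ->). now rewrite (proj1 (HS' x)).
  - rewrite HS. split.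
    + intros (x & Hx & ->). now rewrite (proj2 (HS' x)).
    + intros H. exists (apply_unimod S' z). split; [assumption|now rewrite (proj1 (HS' z))].
Qed.

(** * Freeness, interior lattice points and the conclusion *)

Lemma interior_convex Q : convexset Q -> convexset (pinterior Q).
Proof.
  intros cQ x1 y1 x2 y2 l H1 H2 Hl. destruct (Req_dec l 0) as [->|].
  - match goal with |- pinterior _ ?p => replace p with (x1,y1) by (f_equal; ring) end. assumption.
  - apply interior_between; [assumption|now apply interior_in|assumption|lra].
Qed.

(** The interior of a convex set is convex, so it contains a copy of the triangle as soon as it
    contains the three vertices. *)
Lemma free_of_Delta2_free P : convexset P -> Delta2_free P -> forall S,
  ~ (pinterior P (apply_unimod S (0,0)) /\ pinterior P (apply_unimod S (1,0)) /\
     pinterior P (apply_unimod S (0,1))).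
Proof.
  intros cP fP S (H0 & H1 & H2). apply fP. exists S.
  intros z ([x y] & (l & l0 & l1 & lx & ly) & ->). simpl in l1, lx, ly.
  pose proof (l0 0%nat ltac:(lia)). pose proof (l0 1%nat ltac:(lia)). pose proof (l0 2%nat ltac:(lia)).
  apply interior_of_pull.
  replace (x,y) with (x*1 + y*0 + (1-x-y)*0, x*0 + y*1 + (1-x-y)*0) by (f_equal; ring).
  apply convex3; try lra; try (now apply interior_to_pull).
  now apply interior_convex, convex_pull.
Qed.

Lemma is_tri_of_wide P : polygon P -> Delta2_free P ->
  (exists z1 z2 : Z * Z, z1 <> z2 /\ pinterior P (zpt z1) /\ pinterior P (zpt z2)) ->
  wide P -> is_tri P.
Proof.
  intros ((n & v & HP) & _) fP (z1 & z2 & Hz & I1 & I2) wP.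
  assert (cP : convexset P).
  { intros x1 y1 x2 y2 l H1 H2 Hl. apply HP. apply conv_convex; try assumption; now apply HP. }
  apply (is_tri_of_lattice_pair P z1 z2); try assumption.
  split; [assumption|split; [now apply free_of_Delta2_free|assumption]].
Qed.

Lemma disc_in_square a b e : 0 < e -> a^2 + b^2 < e^2 -> -e < a < e /\ -e < b < e.
Proof.
  intros He H. pose proof (pow2_ge_0 a). pose proof (pow2_ge_0 b).
  repeat split; apply Rnot_le_lt; intro; nra.
Qed.

Lemma Tri_interior_lattice (z : Z * Z) : pinterior Tri (zpt z) <-> (z = (0,0)%Z \/ z = (1,0)%Z).
Proof.
  destruct z as [m n]. unfold zpt; simpl. split.
  - intros (e & He & H).
    (* No side of the triangle is horizontal, so shifting left and right makes all three
       inequalities strict. *)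
    pose proof (H (IZR m - e/2, IZR n)) as H1. pose proof (H (IZR m + e/2, IZR n)) as H2.
    simpl fst in *; simpl snd in *. rewrite Tri_iff in H1, H2.
    specialize (H1 ltac:(nra)). specialize (H2 ltac:(nra)).
    assert (C1 : (n < 2*m+1)%Z) by (apply lt_IZR; rewrite plus_IZR, mult_IZR; lra).
    assert (C2 : (m + n < 2)%Z) by (apply lt_IZR; rewrite plus_IZR; lra).
    assert (C3 : (m < 2 + 2*n)%Z) by (apply lt_IZR; rewrite plus_IZR, mult_IZR; lra).
    assert (n = 0 /\ (m = 0 \/ m = 1))%Z as [-> [-> | ->]] by lia; auto.
  - intros [E|E]; injection E as -> ->; exists (1/4); (split; [lra|]); intros [x y] Hxy;
      simpl fst in Hxy; simpl snd in Hxy; apply Tri_iff.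
    + pose proof (disc_in_square (x-0) (y-0) (1/4) ltac:(lra) Hxy). lra.
    + pose proof (disc_in_square (x-1) (y-0) (1/4) ltac:(lra) Hxy). lra.
Qed.

Theorem theorem4p5 (P : pt -> Prop) :
  polygon P ->
  Delta2_free P ->
  (exists z1 z2 : Z * Z, z1 <> z2 /\ pinterior P (zpt z1) /\ pinterior P (zpt z2)) ->
  Rbar_le (width P) (Finite (10/3)) /\
  (width P = Finite (10/3) <-> unimod_equiv P Tri) /\
  (exists z1 z2 : Z * Z, z1 <> z2 /\
     forall z : Z * Z, pinterior Tri (zpt z) <-> (z = z1 \/ z = z2)).
Proof.
  intros pP fP HZ.
  assert (ge_tri : Rbar_le (Finite (10/3)) (width P) -> is_tri P).
  { intros Hw. apply is_tri_of_wide; try assumption.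
    destruct pP as ((n & v & HP) & (x & Hx)).
    apply (wide_of_width_ge P n v HP); [exists x; now apply interior_in|assumption]. }
  split; [|split].
  - destruct (Rbar_le_lt_dec (width P) (Finite (10/3))) as [H|H]; [assumption|].
    (* A width above 10/3 would also make P equivalent to the triangle, whose width is exactly
       10/3. *)
    rewrite (width_of_is_tri P); [apply Rbar_le_refl|]. apply ge_tri. now apply Rbar_lt_le.
  - rewrite <- is_tri_iff. split; [|apply width_of_is_tri].
    intros E. apply ge_tri. rewrite E. apply Rbar_le_refl.
  - exists (0,0)%Z, (1,0)%Z. split; [congruence|apply Tri_interior_lattice].
Qed.
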